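(* Let $(V,tV)$ be a discrete valuation ring with fraction field $L$ and residue field $K$, and let $\Delta$ be a finite simplicial complex on $\{v_0,v_1,\ldots,v_n\}$. Put $R=V\overline{[\Delta]}$ and $\mathfrak m=(t,x_1,\ldots,x_n)R$. For $\underline a=(a_1,\ldots,a_n)\in\mathbb Z^n$, set $$G_{\underline a}=\{v_i:1\le i\le n,\ a_i<0\},\qquad \Lambda_{\underline a}=\operatorname{link}_\Delta G_{\underline a}.$$ On $\Lambda_{\underline a}$, let $\mathscr F_{\underline a}$ be the cellular sheaf of $V$-modules with values $$\mathscr F_{\underline a}(F)=\begin{cases} L,&v_0\in F,\\ V,&F\in\operatorname{link}_{\Lambda_{\underline a}}\{v_0\},\\ K,&F\notin\overline{\operatorname{St}}_{\Lambda_{\underline a}}\{v_0\},\end{cases}$$ and with restriction maps the identities within each type, the inclusion $V\hookrightarrow L$, and the surjection $V\twoheadrightarrow K$. Then, for every $i$, as $V$-modules, $$[H^i_{\mathfrak m}(R)]_{\underline a}\cong\begin{cases}\widetilde H^{\,i-|G_{\underline a}|-1}(\Lambda_{\underline a};\mathscr F_{\underline a}),&\text{if } a_k\le 0\text{ for all }k,\\ 0,&\text{if some }a_k>0,\end{cases}$$ where the right-hand side is understood to be zero if $G_{\underline a}\notin\Delta$. In particular, writing $\mathscr F_G$ for the corresponding sheaf on $\operatorname{link}_\Delta G$, for every $i$ $$H^i_{\mathfrak m}(R)=0\quad\Longleftrightarrow\quad\widetilde H^{\,i-|G|-1}(\operatorname{link}_\Delta G;\mathscr F_G)=0\ \text{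 for every } G\in\Delta\text{ with } v_0\notin G.$$
   Context: A simplicial complex on $\{v_0,\dots,v_n\}$ is a set of subsets (faces) closed under taking subsets; if nonempty it contains the empty face $\emptyset$; $\dim F=|F|-1$. The $t$-Stanley-Reisner ring is $V\overline{[\Delta]}:=V[x_1,\dots,x_n]/\overline{I_\Delta}$, where $\overline{I_\Delta}$ is generated by the elements $\prod_{v_i\in F}y_i$ for all $F\subseteq\{v_0,\dots,v_n\}$ with $F\notin\Delta$, where $y_0=t$ and $y_i=x_i$ for $i\ge1$. It is $\mathbb Z^n$-graded by multidegree in $x_1,\dots,x_n$, and $H^i_{\mathfrak m}(R)$ inherits the $\mathbb Z^n$-grading from the Čech complex on $t,x_1,\dots,x_n$; $[M]_{\underline a}$ is the degree-$\underline a$ component. For a complex $\Sigma$ and a set of vertices $F$: $\overline{\operatorname{St}}_\Sigma F=\{G\in\Sigma:F\cup G\in\Sigma\}$ and $\operatorname{link}_\Sigma F=\{G\in\Sigma:F\cap G=\emptyset,\ F\cup G\in\Sigma\}$; both are the void complex (no faces at all) if $F\notin\Sigma$. A cellular sheaf on $\Sigma$ is a functor $\mathscr F$ from the poset of faces of $\Sigma$ (including $\emptyset$) under inclusion to $V$-modules; the maps $\mathscr F(F)\to\mathscr F(G)$ for $F\subseteq G$ are called restriction maps. Its reduced cochain complex has $\widetilde C^i(\Sigma;\mathscr F)=\bigoplus_{\dim F=i}\mathscr F(F)$ for $i\ge-1$, with differential whose component $\mathscr F(F)\to\mathscr F(G)$, for $F\subset G$, $\dim G=\dim F+1$, is the restriction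 map times the usual simplicial incidence sign $(-1)^j$ if $F$ is obtained from $G$ by deleting its $j$-th vertex (counting from $0$, vertices in increasing order). $\widetilde H^\bullet(\Sigma;\mathscr F)$ is its cohomology. *)

(* Defs.v *)
From HB Require Import structures.
From mathcomp Require Import all_boot all_order all_algebra.
From mathcomp Require Import boolp.
From mathcomp Require Import mpoly.
From mathcomp Require Import zify.

Set Implicit Arguments.
Unset Strict Implicit.
Unset Printing Implicit Defensive.

Import Order.TTheory GRing.Theory Num.Theory.
Local Open Scope ring_scope.
Local Open Scope quotient_scope.

Record submodule (A : pzRingType) (M : lmodType A) := Submodule {
  sm_mem :> {pred M};
  sm_closed : submod_closed sm_mem
}.

HB.instance Definition _ (A : pzRingType) (M : lmodType A) (N : submodule M) :=
  GRing.isSubmodClosed.Build A M (sm_mem N) (sm_closed N).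

Section SubmoduleOps.
Variables (A : pzRingType) (M : lmodType A).

Lemma submodule_of_subproof (P : M -> Prop) :
  P 0 -> (forall a x y, P x -> P y -> P (a *: x + y)) ->
  submod_closed [pred x | `[< P x >]].
Proof.
move=> P0 PD; split; first by rewrite inE; apply/asboolP.
by move=> a x y; rewrite !inE => /asboolP Px /asboolP Py; apply/asboolP/PD.
Qed.

Definition submodule_of (P : M -> Prop) (P0 : P 0)
    (PD : forall a x y, P x -> P y -> P (a *: x + y)) : submodule M :=
  Submodule (submodule_of_subproof P0 PD).

Lemma submodule_ofE P P0 PD (x : M) : x \in @submodule_of P P0 PD <-> P x.
Proof. by split; rewrite inE => /asboolP. Qed.

Definition in_span (S : M -> Prop) (x : M) : Prop :=
  forall N : submodule M, (forall y, S y -> y \in N) -> x \in N.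

Lemma in_span0 S : in_span S 0.
Proof. by move=> N _; have [] := sm_closed N. Qed.

Lemma in_spanD S a x y : in_span S x -> in_span S y -> in_span S (a *: x + y).
Proof.
by move=> Sx Sy N NS; have [_] := sm_closed N; apply; [apply: Sx|apply: Sy].
Qed.

Definition span (S : M -> Prop) : submodule M :=
  submodule_of (@in_span0 S) (@in_spanD S).

Definition submod_type (N : submodule M) : Type := {x : M | x \in N}.
HB.instance Definition _ (N : submodule M) := SubChoice.on (submod_type N).
HB.instance Definition _ (N : submodule M) :=
  [SubChoice_isSubLmodule of submod_type N by <:].

Definition quotmod (N : submodule M) : Type := {ideal_quot (sm_mem N)}.
HB.instance Definition _ (N : submodule M) := Choice.on (quotmod N).
HB.instance Definition _ (N : submodule M) := GRing.Zmodule.on (quotmod N).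

Definition quot_class (N : submodule M) (x : M) : quotmod N :=
  \pi_({ideal_quot (sm_mem N)}) x.

Lemma quot_class_eq N x y : quot_class N x = quot_class N y <-> x - y \in N.
Proof.
by split=> [/eqP|h]; [|apply/eqP]; rewrite /quot_class -Quotient.idealrBE.
Qed.

Lemma quot_class_surj N (u : quotmod N) : exists x, u = quot_class N x.
Proof. by exists (repr (u : {ideal_quot (sm_mem N)})); rewrite /quot_class reprK. Qed.

Lemma quot_classD N x y :
  quot_class N (x + y) = quot_class N x + quot_class N y.
Proof. exact: raddfD. Qed.

Definition quot_scale (N : submodule M) (a : A) (u : quotmod N) : quotmod N :=
  quot_class N (a *: repr (u : {ideal_quot (sm_mem N)})).

Lemma quot_classZ N a x : quot_class N (a *: x) = quot_scale a (quot_class N x).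
Proof.
apply/quot_class_eq; rewrite -scalerBr rpredZ //.
by apply/quot_class_eq; rewrite /quot_class reprK.
Qed.

Lemma quot_scaleA N a b (u : quotmod N) :
  quot_scale a (quot_scale b u) = quot_scale (a * b) u.
Proof. by have [x ->] := quot_class_surj u; rewrite -!quot_classZ scalerA. Qed.

Lemma quot_scale1 N : left_id 1 (@quot_scale N).
Proof.
by move=> u; have [x ->] := quot_class_surj u; rewrite -quot_classZ scale1r.
Qed.

Lemma quot_scaleDr N : right_distributive (@quot_scale N) +%R.
Proof.
move=> a u v; have [x ->] := quot_class_surj u; have [y ->] := quot_class_surj v.
by rewrite -quot_classD -!quot_classZ scalerDr quot_classD.
Qed.

Lemma quot_scaleDl N (u : quotmod N) : {morph (@quot_scale N)^~ u : a b / a + b}.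
Proof.
move=> a b; have [x ->] := quot_class_surj u.
by rewrite -!quot_classZ scalerDl quot_classD.
Qed.

HB.instance Definition _ (N : submodule M) :=
  GRing.Zmodule_isLmodule.Build A (quotmod N)
    (@quot_scaleA N) (@quot_scale1 N) (@quot_scaleDr N) (@quot_scaleDl N).

End SubmoduleOps.

Section KernelImage.
Variables (A : pzRingType) (M N : lmodType A) (f : {linear M -> N}).

Definition ker_sub : submodule M.
Proof.
apply: (@submodule_of _ _ (fun x => f x = 0)); first exact: raddf0.
by move=> a x y fx fy; rewrite linearP fx fy scaler0 addr0.
Defined.

Definition im_sub : submodule N.
Proof.
apply: (@submodule_of _ _ (fun y => exists x, y = f x)).
  by exists 0; rewrite raddf0.
by move=> a _ _ [x ->] [y ->]; exists (a *: x + y); rewrite linearP.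
Defined.

End KernelImage.

Section SubquotientHomology.
Variables (A : pzRingType) (M' M M'' : lmodType A).
Variables (d' : {linear M' -> M}) (d : {linear M -> M''}).

(* This is im d' :&: ker d, so that no proof of d \o d' = 0 is needed to form the
   quotient; it is im d' for a complex. *)
Definition boundaries : submodule (submod_type (ker_sub d)).
Proof.
apply: (@submodule_of _ _ (fun z => val z \in im_sub d')); first exact: rpred0.
by move=> a x y dx dy; rewrite rpredD // rpredZ.
Defined.

Definition homology : lmodType A := quotmod boundaries.

End SubquotientHomology.

Section ModuleProduct.
Variables (A : pzRingType) (I : finType) (M : I -> lmodType A).

Definition modprod : Type := {dffun forall i : I, M i}.
HB.instance Definition _ := Choice.on modprod.
Implicit Types f g : modprod.

Definition modprod_zero : modprod := [ffun i : I => 0 : M i].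
Definition modprod_opp f : modprod := [ffun i : I => - (f i) : M i].
Definition modprod_add f g : modprod := [ffun i : I => f i + g i : M i].
Definition modprod_scale (a : A) f : modprod := [ffun i : I => a *: f i : M i].

Lemma modprod_addA : associative modprod_add.
Proof. by move=> f g h; apply/ffunP => i; rewrite !ffunE addrA. Qed.
Lemma modprod_addC : commutative modprod_add.
Proof. by move=> f g; apply/ffunP => i; rewrite !ffunE addrC. Qed.
Lemma modprod_add0 : left_id modprod_zero modprod_add.
Proof. by move=> f; apply/ffunP => i; rewrite !ffunE add0r. Qed.
Lemma modprod_addN : left_inverse modprod_zero modprod_opp modprod_add.
Proof. by move=> f; apply/ffunP => i; rewrite !ffunE addNr. Qed.
HB.instance Definition _ := GRing.isZmodule.Build modprod
  modprod_addA modprod_addC modprod_add0 modprod_addN.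

Lemma modprod_scaleA a b f :
  modprod_scale a (modprod_scale b f) = modprod_scale (a * b) f.
Proof. by apply/ffunP => i; rewrite !ffunE scalerA. Qed.
Lemma modprod_scale1 : left_id 1 modprod_scale.
Proof. by move=> f; apply/ffunP => i; rewrite !ffunE scale1r. Qed.
Lemma modprod_scaleDr : right_distributive modprod_scale +%R.
Proof. by move=> a f g; apply/ffunP => i; rewrite !ffunE scalerDr. Qed.
Lemma modprod_scaleDl f : {morph modprod_scale^~ f : a b / a + b}.
Proof. by move=> a b; apply/ffunP => i; rewrite !ffunE scalerDl. Qed.
HB.instance Definition _ := GRing.Zmodule_isLmodule.Build A modprod
  modprod_scaleA modprod_scale1 modprod_scaleDr modprod_scaleDl.

End ModuleProduct.

Definition restr_type (A B : pzRingType) (phi : {rmorphism A -> B})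
  (M : lmodType B) : Type := M.

Section RestrictionOfScalars.
Variables (A B : pzRingType) (phi : {rmorphism A -> B}) (M : lmodType B).
Local Notation Mphi := (restr_type phi M).
HB.instance Definition _ := GRing.Zmodule.on Mphi.

Definition restr_scale (a : A) (x : Mphi) : Mphi := phi a *: (x : M).

Lemma restr_scaleA a b x :
  restr_scale a (restr_scale b x) = restr_scale (a * b) x.
Proof. by rewrite /restr_scale scalerA rmorphM. Qed.
Lemma restr_scale1 : left_id 1 restr_scale.
Proof. by move=> x; rewrite /restr_scale rmorph1 scale1r. Qed.
Lemma restr_scaleDr : right_distributive restr_scale +%R.
Proof. by move=> a x y; rewrite /restr_scale scalerDr. Qed.
Lemma restr_scaleDl x : {morph restr_scale^~ x : a b / a + b}.
Proof. by move=> a b; rewrite /restr_scale rmorphD scalerDl. Qed.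
HB.instance Definition _ := GRing.Zmodule_isLmodule.Build A Mphi
  restr_scaleA restr_scale1 restr_scaleDr restr_scaleDl.

Definition restr : lmodType A := Mphi.

End RestrictionOfScalars.

Definition isomorphic (A : pzRingType) (M N : lmodType A) : Prop :=
  exists f : {linear M -> N}, bijective f.

Definition is_zero_module (A : pzRingType) (M : lmodType A) : Prop :=
  forall x : M, x = 0.

(* Vertices are 0, ..., N-1.  The void complex (no face at all) is allowed, and
   so are vertices i with [set i] not a face. *)
Record scomplex (N : nat) := SComplex {
  faces :> {set {set 'I_N}};
  faces_sub : forall F G : {set 'I_N}, F \in faces -> G \subset F -> G \in faces
}.

Definition full_simplex (N : nat) : scomplex N :=
  @SComplex N [set: {set 'I_N}] (fun F G _ _ => in_setT G).

Section StarLink.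
Variables (N : nat) (Sigma : scomplex N) (F : {set 'I_N}).

Definition star : scomplex N.
Proof.
apply: (@SComplex N [set G in Sigma | F :|: G \in Sigma]) => G H.
rewrite !inE => /andP[GS FGS] HG.
by rewrite (faces_sub GS HG) (faces_sub FGS) // setUS.
Defined.

Definition link : scomplex N.
Proof.
apply: (@SComplex N
  [set G in Sigma | (F :&: G == set0) && (F :|: G \in Sigma)]) => G H.
rewrite !inE => /and3P[GS FG0 FGS] HG.
rewrite (faces_sub GS HG) (faces_sub FGS) ?setUS // andbT /=.
by rewrite -subset0 -(eqP FG0) setIS.
Defined.

Lemma link_void : F \notin Sigma -> link = set0 :> {set {set 'I_N}}.
Proof.
move=> FS; apply/setP => G; rewrite !inE; apply/and3P => -[_ _ FGS].
by case/negP: FS; apply: faces_sub FGS (subsetUl _ _).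
Qed.

End StarLink.

Definition face (N : nat) (Sigma : scomplex N) : Type :=
  {F : {set 'I_N} | F \in Sigma}.
HB.instance Definition _ N (Sigma : scomplex N) := SubFinite.on (face Sigma).

Record cellular_sheaf (A : pzRingType) (N : nat) (Sigma : scomplex N) :=
  CellularSheaf {
    sections : face Sigma -> lmodType A;
    res : forall F G : face Sigma,
      val F \subset val G -> {linear sections F -> sections G};
    res_id : forall (F : face Sigma) (h : val F \subset val F) s, res h s = s;
    res_comp : forall (F G H : face Sigma) (hFG : val F \subset val G)
      (hGH : val G \subset val H) (hFH : val F \subset val H) s,
      res hFH s = res hGH (res hFG s)
  }.

Section Cochains.
Variables (A : comPzRingType) (N : nat) (Sigma : scomplex N).
Variable S : cellular_sheaf A Sigma.

Definition dim_face (F : face Sigma) : int := #|val F|%:Z - 1.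

Definition cell (i : int) : Type := {F : face Sigma | dim_face F == i}.
HB.instance Definition _ i := SubFinite.on (cell i).

Definition cochains (i : int) : lmodType A :=
  modprod (fun F : cell i => sections S (val F)).

Definition res_total (F G : face Sigma) (s : sections S F) : sections S G :=
  if (val F \subset val G) =P true is ReflectT h then res S h s else 0.

(* The exponent is the position of v in G; the inner sum has at most one term.
   The map is defined for all i and j, and is zero unless j = i + 1. *)
Definition coboundary_fun (i j : int) (c : cochains i) : cochains j :=
  [ffun G : cell j =>
    \sum_(F : cell i)
      \sum_(v in val (val G) | val (val F) == val (val G) :\ v)
        (-1) ^+ #|[set w in val (val G) | (w < v)%N]|
          *: res_total (val G) (c F) : sections S (val G)].

Lemma res_totalP F G a (s s' : sections S F) :
  res_total G (a *: s + s') = a *: res_total G s + res_total G s'.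
Proof.
by rewrite /res_total; case: eqP => [h|_]; rewrite ?linearP // scaler0 addr0.
Qed.

Lemma coboundaryP i j : linear (@coboundary_fun i j).
Proof.
move=> a c c'; apply/ffunP => G; rewrite !ffunE scaler_sumr -big_split /=.
apply: eq_bigr => F _; rewrite scaler_sumr -big_split /=.
apply: eq_bigr => v _; rewrite !ffunE res_totalP scalerDr !scalerA.
by rewrite [a * _]mulrC.
Qed.
HB.instance Definition _ i j := GRing.isLinear.Build A (cochains i) (cochains j)
  _ (@coboundary_fun i j) (@coboundaryP i j).

Definition coboundary (i j : int) : {linear cochains i -> cochains j} :=
  @coboundary_fun i j.

Definition cohomology (i : int) : lmodType A :=
  homology (coboundary (i - 1) i) (coboundary i (i + 1)).

End Cochains.

Section Localization.
Variables (R : comPzRingType) (f : R).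

(* (r, k) stands for r / f ^ k. *)
Definition loc_rel (x y : R * nat) : bool :=
  `[< exists m, f ^+ (m + y.2) * x.1 = f ^+ (m + x.2) * y.1 >].

Lemma loc_rel_equiv : equiv_class_of loc_rel.
Proof.
split=> [x|x y|y x z].
- by apply/asboolP; exists 0.
- by apply/idP/idP => /asboolP[m e]; apply/asboolP; exists m.
move=> /asboolP[m e1] /asboolP[p e2]; apply/asboolP.
exists (m + p + y.2)%N.
have -> : (m + p + y.2 + z.2 = (p + z.2) + (m + y.2))%N by lia.
have -> : (m + p + y.2 + x.2 = (m + x.2) + (p + y.2))%N by lia.
by rewrite [LHS](congr1 (fun u => u * _) (exprD _ _ _))
  [RHS](congr1 (fun u => u * _) (exprD _ _ _)) -!mulrA e1 mulrCA e2.
Qed.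

Canonical loc_equiv := EquivRelPack loc_rel_equiv.
Canonical loc_encModRel := defaultEncModRel loc_rel.

Definition loc : Type := {eq_quot loc_rel}.
HB.instance Definition _ := Choice.on loc.

Definition frac (r : R) (k : nat) : loc := \pi_({eq_quot loc_rel}) (r, k).

Lemma frac_eq r s k l :
  frac r k = frac s l <-> exists m, f ^+ (m + l) * r = f ^+ (m + k) * s.
Proof.
split; first by move=> /eqmodP/asboolP.
by move=> h; apply/eqmodP/asboolP.
Qed.

Lemma frac_surj (x : loc) : exists r k, x = frac r k.
Proof.
by exists (repr x).1, (repr x).2; rewrite /frac -surjective_pairing reprK.
Qed.

(* The operations are computed on representatives; see fracD, fracN, fracZ. *)
Definition loc_num (x : loc) : R := (repr x).1.
Definition loc_exp (x : loc) : nat := (repr x).2.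

Lemma loc_repr x : x = frac (loc_num x) (loc_exp x).
Proof. by rewrite /frac -surjective_pairing reprK. Qed.

Definition loc_add (x y : loc) : loc :=
  frac (f ^+ loc_exp y * loc_num x + f ^+ loc_exp x * loc_num y)
       (loc_exp x + loc_exp y).
Definition loc_opp (x : loc) : loc := frac (- loc_num x) (loc_exp x).
Definition loc_scale (a : R) (x : loc) : loc := frac (a * loc_num x) (loc_exp x).

Lemma loc_addE r s k l :
  loc_add (frac r k) (frac s l) = frac (f ^+ l * r + f ^+ k * s) (k + l).
Proof.
rewrite /loc_add; set x := frac r k; set y := frac s l.
have /frac_eq[m e1] := loc_repr x; have /frac_eq[p e2] := loc_repr y.
move: (loc_num x) (loc_exp x) (loc_num y) (loc_exp y) e1 e2 => u i v j e1 e2.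
apply/frac_eq; exists (m + p)%N; rewrite !mulrDr !mulrA -!exprD.
have -> : (m + p + (k + l) + j = (p + l + j) + (m + k))%N by lia.
have -> : (m + p + (k + l) + i = (m + k + i) + (p + l))%N by lia.
have -> : (m + p + (i + j) + l = (p + l + j) + (m + i))%N by lia.
have -> : (m + p + (i + j) + k = (m + k + i) + (p + j))%N by lia.
by rewrite [f ^+ (_ + (m + k))]exprD [f ^+ (_ + (p + l))]exprD
  [f ^+ (_ + (m + i))]exprD [f ^+ (_ + (p + j))]exprD -!mulrA e1 e2.
Qed.

Lemma loc_oppE r k : loc_opp (frac r k) = frac (- r) k.
Proof.
have /frac_eq[m e] := loc_repr (frac r k); apply/frac_eq; exists m.
by rewrite !mulrN e.
Qed.

Lemma loc_scaleE a r k : loc_scale a (frac r k) = frac (a * r) k.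
Proof.
have /frac_eq[m e] := loc_repr (frac r k); apply/frac_eq; exists m.
by rewrite mulrCA -e mulrCA.
Qed.

Lemma frac_cancel r k m : frac (f ^+ m * r) (m + k) = frac r k.
Proof. by apply/frac_eq; exists 0%N; rewrite !add0n mulrA -exprD addnC. Qed.

Lemma loc_addA : associative loc_add.
Proof.
move=> x y z; have [r [k ->]] := frac_surj x; have [s [l ->]] := frac_surj y.
have [u [p ->]] := frac_surj z; rewrite !loc_addE addnA; congr frac.
rewrite !mulrDr !mulrA -!exprD addrA.
by congr (_ ^+ _ * _ + _ ^+ _ * _ + _ ^+ _ * _); lia.
Qed.
Lemma loc_addC : commutative loc_add.
Proof.
move=> x y; have [r [k ->]] := frac_surj x; have [s [l ->]] := frac_surj y.
by rewrite !loc_addE addrC addnC.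
Qed.
Lemma loc_add0 : left_id (frac 0 0) loc_add.
Proof.
move=> x; have [r [k ->]] := frac_surj x.
by rewrite loc_addE mulr0 add0r expr0 mul1r.
Qed.
Lemma loc_addN : left_inverse (frac 0 0) loc_opp loc_add.
Proof.
move=> x; have [r [k ->]] := frac_surj x.
rewrite loc_oppE loc_addE mulrN addNr; apply/frac_eq; exists 0%N.
by rewrite !mulr0.
Qed.
HB.instance Definition _ :=
  GRing.isZmodule.Build loc loc_addA loc_addC loc_add0 loc_addN.

Lemma fracD r s k l :
  frac r k + frac s l = frac (f ^+ l * r + f ^+ k * s) (k + l).
Proof. exact: loc_addE. Qed.

Lemma loc_scaleA a b x : loc_scale a (loc_scale b x) = loc_scale (a * b) x.
Proof. by have [r [k ->]] := frac_surj x; rewrite !loc_scaleE mulrA. Qed.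
Lemma loc_scale1 : left_id 1 loc_scale.
Proof.
by move=> x; have [r [k ->]] := frac_surj x; rewrite !loc_scaleE mul1r.
Qed.
Lemma loc_scaleDr : right_distributive loc_scale +%R.
Proof.
move=> a x y; have [r [k ->]] := frac_surj x; have [s [l ->]] := frac_surj y.
by rewrite fracD !loc_scaleE fracD mulrDr !(mulrCA a).
Qed.
Lemma loc_scaleDl x : {morph loc_scale^~ x : a b / a + b}.
Proof.
move=> a b; have [r [k ->]] := frac_surj x.
by rewrite !loc_scaleE fracD -mulrDr -mulrDl frac_cancel.
Qed.
HB.instance Definition _ := GRing.Zmodule_isLmodule.Build R loc
  loc_scaleA loc_scale1 loc_scaleDr loc_scaleDl.

Lemma fracN r k : - frac r k = frac (- r) k.
Proof. exact: loc_oppE. Qed.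
Lemma fracZ a r k : a *: frac r k = frac (a * r) k.
Proof. exact: loc_scaleE. Qed.

End Localization.

Section LocalizationMap.
Variables (R : comPzRingType) (f g h : R) (fh : g = f * h).

(* The canonical map R_f -> R_(f h), r / f ^ k |-> r h ^ k / (f h) ^ k. *)
Definition loc_map_fun (x : loc f) : loc g :=
  frac g (h ^+ loc_exp x * loc_num x) (loc_exp x).

Lemma loc_map_aux a b u : g ^+ a * (h ^+ b * u) = h ^+ (a + b) * (f ^+ a * u).
Proof. by rewrite fh exprMn exprD -!mulrA !(mulrCA (f ^+ a)). Qed.

Lemma loc_map_funE r k : loc_map_fun (frac f r k) = frac g (h ^+ k * r) k.
Proof.
have /frac_eq[m e] := loc_repr (frac f r k).
rewrite /loc_map_fun; move: (loc_num _) (loc_exp _) e => s l e.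
apply/frac_eq; exists m; rewrite !loc_map_aux e.
by congr (_ ^+ _ * _); lia.
Qed.

Lemma loc_mapP : linear loc_map_fun.
Proof.
move=> a x y; have [r [k ->]] := frac_surj x; have [s [l ->]] := frac_surj y.
rewrite fracZ fracD !loc_map_funE fracZ fracD; congr frac.
by rewrite (mulrCA a) !loc_map_aux mulrDr [(l + k)%N]addnC.
Qed.
HB.instance Definition _ := GRing.isLinear.Build R (loc f) (loc g)
  _ loc_map_fun loc_mapP.

Definition loc_map : {linear loc f -> loc g} := loc_map_fun.

Lemma loc_mapE r k : loc_map (frac f r k) = frac g (h ^+ k * r) k.
Proof. exact: loc_map_funE. Qed.

End LocalizationMap.

Section QuotientRing.
Variables (A : comPzRingType) (I : submodule A^o).

(* I need not be proper, so this is only a pzRing. *)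
Definition quotring : Type := quotmod I.
HB.instance Definition _ := GRing.Zmodule.on quotring.

Definition ring_class (x : A) : quotring := quot_class I x.

Lemma ring_class_eq x y : ring_class x = ring_class y <-> x - y \in I.
Proof. exact: quot_class_eq. Qed.

Lemma ring_class_surj (u : quotring) : exists x, u = ring_class x.
Proof. by have [x e] := @quot_class_surj _ _ I u; exists x. Qed.

Definition quotring_rep (u : quotring) : A :=
  repr (u : {ideal_quot (sm_mem I)}).

Lemma quotring_repK u : ring_class (quotring_rep u) = u.
Proof. by rewrite /ring_class /quot_class reprK. Qed.

Definition quotring_mul (u v : quotring) : quotring :=
  ring_class (quotring_rep u * quotring_rep v).

Lemma ring_class_zmod : zmod_morphism ring_class.
Proof. by move=> x y; rewrite /ring_class /quot_class raddfB. Qed.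

Lemma ring_classM x y :
  ring_class (x * y) = quotring_mul (ring_class x) (ring_class y).
Proof.
have [I0 ID] := sm_closed I.
have /ring_class_eq hx := quotring_repK (ring_class x).
have /ring_class_eq hy := quotring_repK (ring_class y).
apply/esym/ring_class_eq; set u := quotring_rep _; set v := quotring_rep _.
have -> : u * v - x * y = v * (u - x) + x * (v - y).
  by rewrite !mulrBr (mulrC v u) (mulrC v x) addrA subrK.
by apply: (ID v) => //; rewrite -[x * _]addr0; apply: (ID x).
Qed.

Lemma quotring_mulA : associative quotring_mul.
Proof.
move=> u v w; have [x ->] := ring_class_surj u; have [y ->] := ring_class_surj v.
by have [z ->] := ring_class_surj w; rewrite -!ring_classM mulrA.
Qed.
Lemma quotring_mulC : commutative quotring_mul.
Proof. by move=> u v; rewrite /quotring_mul mulrC. Qed.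
Lemma quotring_mul1 : left_id (ring_class 1) quotring_mul.
Proof.
by move=> u; have [x ->] := ring_class_surj u; rewrite -ring_classM mul1r.
Qed.
Lemma quotring_mulDl : left_distributive quotring_mul +%R.
Proof.
have D x y : ring_class (x + y) = ring_class x + ring_class y.
  by rewrite /ring_class /quot_class raddfD.
move=> u v w; have [x ->] := ring_class_surj u; have [y ->] := ring_class_surj v.
by have [z ->] := ring_class_surj w; rewrite -D -!ring_classM mulrDl D.
Qed.
HB.instance Definition _ := GRing.Zmodule_isComPzRing.Build quotring
  quotring_mulA quotring_mulC quotring_mul1 quotring_mulDl.

HB.instance Definition _ :=
  GRing.isZmodMorphism.Build A quotring ring_class ring_class_zmod.
HB.instance Definition _ :=
  GRing.isMonoidMorphism.Build A quotring ring_class (erefl, ring_classM).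

End QuotientRing.

Section Cech.
Variables (R : comPzRingType) (N : nat) (y : 'I_N -> R).

Lemma cech_prod (S T : {set 'I_N}) : S \subset T ->
  \prod_(i in T) y i = \prod_(i in S) y i * \prod_(i in T :\: S) y i.
Proof.
move=> ST; rewrite (big_setID S) /=; congr (_ * _).
by apply: eq_bigl => i; have /setIidPr -> := ST.
Qed.

Definition cech_sections (F : face (full_simplex N)) : lmodType R :=
  loc (\prod_(i in val F) y i).

Definition cech_res (F G : face (full_simplex N)) (h : val F \subset val G) :
    {linear cech_sections F -> cech_sections G} :=
  loc_map (cech_prod h).

Lemma cech_res_id (F : face (full_simplex N)) (h : val F \subset val F) s : cech_res h s = s.
Proof.
have [r [k ->]] := frac_surj s; rewrite /cech_res loc_mapE setDv big_set0.
by rewrite expr1n mul1r.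
Qed.

Lemma cech_res_comp (F G H : face (full_simplex N)) (hFG : val F \subset val G)
    (hGH : val G \subset val H) (hFH : val F \subset val H) s :
  cech_res hFH s = cech_res hGH (cech_res hFG s).
Proof.
have [r [k ->]] := frac_surj s; rewrite [cech_res hFG _]loc_mapE.
rewrite [LHS]loc_mapE [RHS]loc_mapE mulrA -exprMn.
congr (frac _ (_ ^+ _ * _) _); rewrite mulrC.
rewrite (big_setID (val G)) /=; congr (_ * _); apply: eq_bigl => i.
  rewrite !inE; have /subsetP/(_ i) := hGH.
  by case: (i \in val G) => [->//|_]; rewrite ?andbT ?andbF.
rewrite !inE; have /subsetP/(_ i) := hFG.
by case: (i \in val F) => [->//|_].
Qed.

Definition cech_sheaf : cellular_sheaf R (full_simplex N) :=
  CellularSheaf cech_res_id cech_res_comp.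

(* The Cech complex of y has the sum of the R_(y_S) with |S| = i in degree i: it
   is the reduced cochain complex of S |-> R_(y_S) shifted by one. *)
Definition cech_cohomology (i : int) : lmodType R :=
  cohomology cech_sheaf (i - 1).

End Cech.

Section StanleyReisner.
Variables (V : idomainType) (t : V) (n : nat) (Delta : scomplex n.+1).

(* ord0 is v_0 and lift ord0 j is v_(j+1). *)
Definition SR_var (i : 'I_n.+1) : {mpoly V[n]} :=
  if unlift ord0 i is Some j then 'X_j else t%:MP.

Definition SR_ideal : submodule {mpoly V[n]}^o :=
  @span _ {mpoly V[n]}^o (fun p : {mpoly V[n]} =>
    exists2 F : {set 'I_n.+1}, F \notin Delta & p = \prod_(i in F) SR_var i).

Definition SR_ring : comPzRingType := quotring SR_ideal.

Definition SR_class : {rmorphism {mpoly V[n]} -> SR_ring} := @ring_class _ _.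
Definition SR_alg : {rmorphism V -> SR_ring} := SR_class \o @mpolyC n V.

Definition SR_elt (i : 'I_n.+1) : SR_ring := SR_class (SR_var i).

(* Local cohomology at m = (t, x_1, ..., x_n), on its Cech model. *)
Definition local_cohomology (i : int) : lmodType SR_ring :=
  cech_cohomology SR_elt i.

Definition SR_homog (b : 'I_n -> int) (r : SR_ring) : Prop :=
  exists2 p : {mpoly V[n]}, r = SR_class p
    & forall m, m \in msupp p -> forall j, (m j)%:Z = b j.

(* x is homogeneous of degree b in R_(y_S): it is r / y_S ^ k with r homogeneous
   of degree b + k deg y_S. *)
Definition loc_homog (S : {set 'I_n.+1}) (b : 'I_n -> int)
    (x : loc (\prod_(i in S) SR_elt i)) : Prop :=
  exists r k, x = frac _ r k /\
    SR_homog (fun j => b j + k%:Z * (lift ord0 j \in S)%:Z) r.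

Lemma SR_homogP b (a : V) r s :
  SR_homog b r -> SR_homog b s -> SR_homog b (SR_alg a * r + s).
Proof.
move=> [p -> hp] [q -> hq]; exists (a%:MP * p + q).
  by rewrite rmorphD rmorphM.
move=> m /msuppD_le; rewrite mem_cat => /orP[|/hq //].
by rewrite mul_mpolyC => /msuppZ_le /hp.
Qed.

Lemma SR_homog_var b r i : SR_homog b r ->
  SR_homog (fun j => b j + (lift ord0 j == i)%:Z) (SR_elt i * r).
Proof.
move=> [p -> hp]; exists (SR_var i * p); first by rewrite rmorphM.
rewrite /SR_var; case: unliftP => [j ->|->] m.
  rewrite -mulrC (perm_mem (msuppMX _ _)) => /mapP[m' /hp hm ->] k.
  by rewrite mnmDE mnm1E PoszD addrC hm (inj_eq lift_inj) eq_sym addrC.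
rewrite mul_mpolyC => /msuppZ_le /hp hm k.
by rewrite hm eq_sym (negPf (neq_lift _ _)) addr0.
Qed.

Lemma SR_homog_eq b b' r : b =1 b' -> SR_homog b r -> SR_homog b' r.
Proof. by move=> /funext->. Qed.

Lemma SR_homog_prod (S : {set 'I_n.+1}) b r : SR_homog b r ->
  SR_homog (fun j => b j + (lift ord0 j \in S)%:Z)
    ((\prod_(i in S) SR_elt i) * r).
Proof.
move=> hr; rewrite -big_enum /=.
apply: (@SR_homog_eq (fun j => b j + (count_mem (lift ord0 j) (enum S))%:Z)).
  by move=> j; rewrite count_uniq_mem ?enum_uniq // mem_enum.
elim: (enum S) => [|i s IH].
  by rewrite big_nil mul1r; apply: SR_homog_eq hr => j; rewrite addr0.
rewrite big_cons -mulrA; apply: SR_homog_eq (SR_homog_var i IH) => j.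
by rewrite /= PoszD -addrA [X in _ + X]addrC [i == _]eq_sym.
Qed.

Lemma SR_homog_exp (S : {set 'I_n.+1}) k b r : SR_homog b r ->
  SR_homog (fun j => b j + k%:Z * (lift ord0 j \in S)%:Z)
    ((\prod_(i in S) SR_elt i) ^+ k * r).
Proof.
move=> hr; elim: k => [|k IH].
  by rewrite mul1r; apply: SR_homog_eq hr => j; rewrite mul0r addr0.
rewrite exprS -mulrA; apply: SR_homog_eq (SR_homog_prod S IH) => j.
by rewrite -addrA -[in RHS]addn1 PoszD mulrDl mul1r.
Qed.

Lemma SR_homog0 b : SR_homog b 0.
Proof. by exists 0; rewrite ?rmorph0 // => m; rewrite msupp0. Qed.

Lemma loc_homogP (S : {set 'I_n.+1}) b (a : V)
    (x y : loc (\prod_(i in S) SR_elt i)) :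
  loc_homog b x -> loc_homog b y -> loc_homog b (SR_alg a *: x + y).
Proof.
move=> [r [k [-> hr]]] [s [l [-> hs]]].
set d := (fun j => b j + (k + l)%:Z * (lift ord0 j \in S)%:Z).
have {}hr : SR_homog d ((\prod_(i in S) SR_elt i) ^+ l * r).
  apply: SR_homog_eq (SR_homog_exp S l hr) => j.
  by rewrite /d PoszD mulrDl addrA.
have {}hs : SR_homog d ((\prod_(i in S) SR_elt i) ^+ k * s).
  apply: SR_homog_eq (SR_homog_exp S k hs) => j.
  by rewrite /d PoszD mulrDl addrA addrAC.
exists (SR_alg a * ((\prod_(i in S) SR_elt i) ^+ l * r)
        + (\prod_(i in S) SR_elt i) ^+ k * s), (k + l)%N; split.
  by rewrite fracZ fracD mulrCA.
exact: SR_homogP.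
Qed.

(* The component of degree a of H^i_m(R), a V-submodule: the classes of the
   cocycles all of whose components are homogeneous of degree a. *)
Definition local_cohomology_deg (i : int) (a : 'I_n -> int) :
  submodule (restr SR_alg (local_cohomology i)).
Proof.
apply: (@submodule_of _ _ (fun u : restr SR_alg (local_cohomology i) =>
  exists2 z, u = quot_class (boundaries _ _) z
  & forall S, @loc_homog (val (val S)) a (val z S))).
- exists 0; first by rewrite /quot_class raddf0.
  move=> S; rewrite ffunE; exists 0, 0%N; split=> //; exact: SR_homog0.
- move=> c _ _ [z -> hz] [w -> hw]; exists (SR_alg c *: z + w).
    by rewrite quot_classD quot_classZ.
  by move=> S; rewrite !ffunE; apply: loc_homogP.
Defined.

End StanleyReisner.

(* V is a principal ideal domain that is not a field, and its non-units are the
   multiples of t; that is, V is a DVR with maximal ideal t V. *)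
Definition is_dvr (V : idomainType) (t : V) : Prop :=
  [/\ t != 0,
      forall x : V, x \isn't a GRing.unit <-> exists y, x = t * y
    & forall I : submodule V^o, exists a : V,
        forall x : V, x \in I <-> exists y, x = y * a].

Definition is_fraction_field (V : idomainType) (L : fieldType)
    (iota : {rmorphism V -> L}) : Prop :=
  injective iota /\
  forall z : L, exists x y : V, y != 0 /\ z = iota x / iota y.

Definition is_residue_field (V : idomainType) (t : V) (K : fieldType)
    (pi : {rmorphism V -> K}) : Prop :=
  (forall z : K, exists x : V, z = pi x) /\
  forall x : V, pi x = 0 <-> exists y, x = t * y.

Section DvrSheaf.
Variables (V : idomainType) (L K : fieldType).
Variables (iota : {rmorphism V -> L}) (pi : {rmorphism V -> K}).

Inductive stalk_type := StalkL | StalkV | StalkK.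

Definition stalk (s : stalk_type) : lmodType V :=
  match s with
  | StalkL => restr iota L^o
  | StalkV => V^o
  | StalkK => restr pi K^o
  end.

Definition stalk_iota (x : stalk StalkV) : stalk StalkL := iota x.
Definition stalk_pi (x : stalk StalkV) : stalk StalkK := pi x.

Lemma stalk_iotaP : linear stalk_iota.
Proof. by move=> a x y; rewrite /stalk_iota rmorphD rmorphM. Qed.
Lemma stalk_piP : linear stalk_pi.
Proof. by move=> a x y; rewrite /stalk_pi rmorphD rmorphM. Qed.
HB.instance Definition _ :=
  GRing.isLinear.Build V (stalk StalkV) (stalk StalkL) _ stalk_iota stalk_iotaP.
HB.instance Definition _ :=
  GRing.isLinear.Build V (stalk StalkV) (stalk StalkK) _ stalk_pi stalk_piP.

(* The null maps are placeholders: by face_type_le below, they never occur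
   between the stalks of faces F \subset G. *)
Definition stalk_res (s s' : stalk_type) : {linear stalk s -> stalk s'} :=
  match s, s' return {linear stalk s -> stalk s'} with
  | StalkL, StalkL => idfun
  | StalkV, StalkV => idfun
  | StalkK, StalkK => idfun
  | StalkV, StalkL => stalk_iota
  | StalkV, StalkK => stalk_pi
  | _, _ => \0
  end.

Variables (n : nat) (Lambda : scomplex n.+1).

Definition face_type (F : {set 'I_n.+1}) : stalk_type :=
  if ord0 \in F then StalkL
  else if F \in link Lambda [set ord0] then StalkV
  else StalkK.

Lemma face_typeK (F : {set 'I_n.+1}) : F \in Lambda ->
  (face_type F = StalkK) <-> F \notin star Lambda [set ord0].
Proof.
move=> FL; rewrite /face_type !inE FL /=.
have -> : ([set ord0] :&: F == set0) = (ord0 \notin F).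
  by rewrite setI_eq0 disjoints1.
case: (boolP (ord0 \in F)) => [F0|F0] /=; last by case: ifP.
split=> // /negP[].
by rewrite (setUidPr _) // sub1set.
Qed.

Lemma face_typeL (F : {set 'I_n.+1}) : (face_type F = StalkL) <-> ord0 \in F.
Proof. by rewrite /face_type; case: ifP => // _; case: ifP. Qed.

Lemma face_type_le (F G : {set 'I_n.+1}) :
  F \in Lambda -> G \in Lambda -> F \subset G ->
  face_type F = StalkV \/ face_type F = face_type G.
Proof.
move=> FL GL FG; case E: (face_type F); [right|by left|right].
  by apply/esym/face_typeL; apply: (subsetP FG); apply/face_typeL.
have /(face_typeK FL) := E; rewrite !inE FL /= => FS.
apply/esym/(face_typeK GL); rewrite !inE GL /=.
by apply: contra FS => GS; apply: faces_sub GS _; rewrite setUS.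
Qed.

Definition dvr_sheaf_sections (F : face Lambda) : lmodType V :=
  stalk (face_type (val F)).

Definition dvr_sheaf_res (F G : face Lambda) (h : val F \subset val G) :
    {linear dvr_sheaf_sections F -> dvr_sheaf_sections G} :=
  stalk_res (face_type (val F)) (face_type (val G)).

Lemma stalk_res_id s x : stalk_res s s x = x.
Proof. by case: s x. Qed.

Lemma dvr_sheaf_res_id (F : face Lambda) (h : val F \subset val F) s :
  dvr_sheaf_res h s = s.
Proof. exact: stalk_res_id. Qed.

Lemma dvr_sheaf_res_comp (F G H : face Lambda) (hFG : val F \subset val G)
    (hGH : val G \subset val H) (hFH : val F \subset val H) s :
  dvr_sheaf_res hFH s = dvr_sheaf_res hGH (dvr_sheaf_res hFG s).
Proof.
have := face_type_le (valP F) (valP G) hFG.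
have := face_type_le (valP G) (valP H) hGH.
move: s; rewrite /dvr_sheaf_res /dvr_sheaf_sections.
move: (face_type (val F)) (face_type (val G)) (face_type (val H)).
by move=> [] [] [] s [] // e1 [] // e2; rewrite ?stalk_res_id.
Qed.

Definition dvr_sheaf : cellular_sheaf V Lambda :=
  CellularSheaf dvr_sheaf_res_id dvr_sheaf_res_comp.

End DvrSheaf.

Definition neg_support (n : nat) (a : 'I_n -> int) : {set 'I_n.+1} :=
  [set lift ord0 k | k : 'I_n & a k < 0].

(* Main.v *)
Require Import Defs.
From HB Require Import structures.
From mathcomp Require Import all_boot all_order all_algebra.
From mathcomp Require Import mpoly.
From mathcomp Require Import boolp zify ring.

Set Implicit Arguments.
Unset Strict Implicit.
Unset Printing Implicit Defensive.

Import Order.TTheory GRing.Theory Num.Theory.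
Local Open Scope ring_scope.

(* The ideal of the t-Stanley-Reisner ring is monomial, so R is the direct sum,
   over the monomials x^m, of copies of V, K or 0 according to the support of m.
   Hence, with P the set of vertices of positive degree and G that of negative
   degree, the degree a component of R_(y_S) vanishes unless G \subset S and
   U = S \cup P is a face; it is then L if v_0 \in U, V if v_0 \notin U and v_0
   extends U to a face, and K otherwise. The isomorphism sends r / y_S ^ k to c,
   or to c / t ^ k if v_0 \in U, where c is the coefficient of r in degree
   a + k deg y_S. If P is empty, the faces S = G \cup F with F in the link of G
   identify the degree a part of the Cech complex with the cochain complex of
   F_a, up to the shuffle sign of G and F. If P contains v, restriction from S to
   S \cup {v} is bijective in degree a, and its inverse contracts the complex.
   The vanishing criterion follows because every cocycle is a finite sum of
   homogeneous cocycles. *)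

(** * Homology *)

Lemma inj_surj_bijective (T U : Type) (f : T -> U) :
  injective f -> (forall y, exists x, y = f x) -> bijective f.
Proof.
move=> f_inj /choice[g gK].
by exists g => [x|y]; [apply: f_inj|]; rewrite -gK.
Qed.

Lemma ker_subE (A : pzRingType) (M N : lmodType A) (f : {linear M -> N}) x :
  x \in ker_sub f <-> f x = 0.
Proof. exact: submodule_ofE. Qed.

Section Homology.
Variables (A : pzRingType) (M' M M'' : lmodType A).
Variables (d' : {linear M' -> M}) (d : {linear M -> M''}).

Definition cocycle (z : M) (dz : d z = 0) : submod_type (ker_sub d) :=
  exist _ z ((ker_subE d z).2 dz).

Lemma cocycleP (z : submod_type (ker_sub d)) : d (val z) = 0.
Proof. by apply/ker_subE; apply: (valP z). Qed.

Definition cohomology_class (z : M) (dz : d z = 0) : homology d' d :=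
  quot_class (boundaries d' d) (cocycle dz).

Lemma homology_surj (u : homology d' d) :
  exists z (dz : d z = 0), u = cohomology_class dz.
Proof.
have [z ->] := quot_class_surj u.
by exists (val z), (cocycleP z); congr quot_class; apply: val_inj.
Qed.

Lemma quot_class_boundary (z z' : submod_type (ker_sub d)) :
  quot_class (boundaries d' d) z = quot_class (boundaries d' d) z' <->
  exists w, val z - val z' = d' w.
Proof.
rewrite quot_class_eq submodule_ofE.
exact: (submodule_ofE _ _ (val z - val z')).
Qed.

Lemma cohomology_class_eq0 z (dz : d z = 0) :
  cohomology_class dz = 0 <-> exists w, z = d' w.
Proof.
have -> : 0 = quot_class (boundaries d' d) 0 by rewrite /quot_class raddf0.
by rewrite quot_class_boundary subr0.
Qed.

End Homology.

(** * Homology classes with homogeneous representatives *)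

Section HomogeneousHomology.
Variables (A B : pzRingType) (phi : {rmorphism A -> B}).
Variables (M' M M'' : lmodType B) (d' : {linear M' -> M}) (d : {linear M -> M''}).
Variables (N' N N'' : lmodType A) (e' : {linear N' -> N}) (e : {linear N -> N''}).
Variables (rho' : M' -> N') (rho : M -> N) (rho'' : M'' -> N'').
Variables (hom' : M' -> Prop) (hom : M -> Prop) (hom'' : M'' -> Prop).
Hypothesis rhoP : forall a x y, rho (phi a *: x + y) = a *: rho x + rho y.
Hypothesis rho''0 : rho'' 0 = 0.
Hypothesis rho_d' : forall x, rho (d' x) = e' (rho' x).
Hypothesis rho_d : forall x, rho'' (d x) = e (rho x).
Hypothesis homB : forall x y, hom x -> hom y -> hom (x - y).
Hypothesis hom_d' : forall x, hom' x -> hom (d' x).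
Hypothesis hom_d : forall x, hom x -> hom'' (d x).
Hypothesis rho_inj : forall x, hom x -> rho x = 0 -> x = 0.
Hypothesis rho_inj'' : forall x, hom'' x -> rho'' x = 0 -> x = 0.
Hypothesis rho_surj' : forall y, exists2 x, hom' x & y = rho' x.
Hypothesis rho_surj : forall y, exists2 x, hom x & y = rho x.
Variable W : submodule (restr phi (homology d' d)).
Hypothesis W_mem : forall u : homology d' d, u \in W <->
  exists2 z, u = quot_class (boundaries d' d) z & hom (val z).

(** [W] consists of the classes of homogeneous cocycles. The cochain [w] is arbitrary, since a class
    is compared with zero in the whole homology. *)
Lemma homogeneous_homology_eq0 :
  is_zero_module (submod_type W) <->
  forall z, d z = 0 -> hom z -> exists w, z = d' w.
Proof.
split=> [W0 z dz hz|H0 u].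
  have zW : cohomology_class d' dz \in W by apply/W_mem; exists (cocycle dz).
  have /(congr1 val) : (exist (fun u => u \in W) _ zW : submod_type W) = 0 by apply: W0.
  by move=> /cohomology_class_eq0.
apply: val_inj => /=; have [z -> hz] := (W_mem (val u)).1 (valP u).
have -> : z = cocycle (cocycleP z) by apply: val_inj.
exact/cohomology_class_eq0/(H0 _ (cocycleP z) hz).
Qed.

Lemma rhoB x y : rho (x - y) = rho x - rho y.
Proof.
(* [rhoP] handles only scalars coming from [A], and [-1] is [phi (-1)]. *)
by rewrite addrC -scaleN1r -[X in X *: y](rmorphN1 phi) rhoP scaleN1r addrC.
Qed.

Lemma rho_cocycle (z : submod_type (ker_sub d)) : e (rho (val z)) = 0.
Proof. by rewrite -rho_d cocycleP. Qed.

Definition rho_class (z : submod_type (ker_sub d)) : homology e' e :=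
  cohomology_class e' (rho_cocycle z).

Lemma rho_class_eq (z z' : submod_type (ker_sub d)) :
  quot_class (boundaries d' d) z = quot_class (boundaries d' d) z' ->
  rho_class z = rho_class z'.
Proof.
move=> /quot_class_boundary[w zz'].
by apply/quot_class_boundary; exists (rho' w); rewrite /= -rhoB zz' rho_d'.
Qed.

(** The chosen representative may fail to be homogeneous: [rho] is a cochain map on the whole
    complex, so by [rho_class_eq] the choice does not matter. *)
Definition rho_homology (u : submod_type W) : homology e' e :=
  rho_class (sval (cid (quot_class_surj (val u : homology d' d)))).

Lemma rho_homologyE (u : submod_type W) z :
  val u = quot_class (boundaries d' d) z -> rho_homology u = rho_class z.
Proof.
move=> uz; rewrite /rho_homology; case: cid => z' /= uz'.
by apply: rho_class_eq; rewrite -uz' uz.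
Qed.

Lemma rho_homology_linear : linear rho_homology.
Proof.
move=> a u v.
have [z uz] := quot_class_surj (val u : homology d' d).
have [w vw] := quot_class_surj (val v : homology d' d).
rewrite (rho_homologyE uz) (rho_homologyE vw).
have -> : rho_homology (a *: u + v) = rho_class (phi a *: z + w).
  by apply: rho_homologyE; rewrite /= quot_classD quot_classZ -uz -vw.
rewrite /rho_class /cohomology_class.
rewrite -[a *: quot_class _ _]quot_classZ -quot_classD; congr quot_class.
by apply: val_inj; rewrite /= rhoP.
Qed.

HB.instance Definition _ := GRing.isLinear.Build A (submod_type W)
  (homology e' e) _ rho_homology rho_homology_linear.

(** If [rho z] is the boundary of [n'], a homogeneous lift [w'] of [n'] makes [z - d' w']
    homogeneous and killed by [rho], hence zero. For surjectivity, a homogeneous lift of a cocycle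
    is a cocycle, because [rho''] kills no nonzero homogeneous element. *)
Lemma homogeneous_homology_iso :
  isomorphic (submod_type W : lmodType A) (homology e' e).
Proof.
exists (rho_homology : {linear _ -> _}); apply: inj_surj_bijective.
  apply: raddf_inj => u.
  have [z uz homz] := (W_mem (val u)).1 (valP u).
  rewrite /= (rho_homologyE uz) => /cohomology_class_eq0[n'].
  have [w' homw' ->] := rho_surj' n'; rewrite -rho_d' => rhoz.
  have /eqP : val z - d' w' = 0.
    by apply: rho_inj; rewrite ?rhoB ?rhoz ?subrr //; apply/homB/hom_d'.
  rewrite subr_eq0 => /eqP zw'; apply: val_inj; rewrite uz /=.
  have -> : 0 = quot_class (boundaries d' d) 0 by rewrite /quot_class raddf0.
  by apply/quot_class_boundary; exists w'; rewrite subr0.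
move=> y; have [c [ec ->]] := homology_surj y.
have [z homz cz] := rho_surj c.
have dz : d z = 0.
  by apply: rho_inj''; [apply: hom_d|rewrite rho_d -cz].
have zW : quot_class (boundaries d' d) (cocycle dz) \in W.
  by apply/W_mem; exists (cocycle dz).
exists (exist (fun u => u \in W) _ zW).
apply/esym/(etrans (@rho_homologyE _ (cocycle dz) _)) => //.
by congr quot_class; apply: val_inj; rewrite /= cz.
Qed.

End HomogeneousHomology.

(** * Cochains of cellular sheaves *)

Definition face_del (N : nat) (Sigma : scomplex N) (G : face Sigma) (v : 'I_N) :
    face Sigma :=
  exist _ (val G :\ v) (faces_sub (valP G) (subD1set _ _)).

(** For [v] in [G] this is the position of [v]; [twist] also applies it to [v] outside [G]. *)
Definition incidence_exp (N : nat) (G : {set 'I_N}) (v : 'I_N) : nat :=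
  #|[set w in G | (w < v)%N]|.

Section CoboundaryFormula.
Variables (A : comPzRingType) (N : nat) (Sigma : scomplex N).
Variable S : cellular_sheaf A Sigma.

(** Extension by zero to all dimensions allows evaluation at a face without a proof of its
    dimension. *)
Definition cochain_ext i (c : cochains S i) (F : face Sigma) : sections S F :=
  if @idP (dim_face F == i) is ReflectT h
  then c (exist (fun F => dim_face F == i) F h) else 0.

Lemma cochain_extE i (c : cochains S i) (F : cell Sigma i) :
  cochain_ext c (val F) = c F.
Proof.
rewrite /cochain_ext; case: {-}_ / idP => [h|/negP/negP]; last first.
  by have := valP F => /= ->.
by case: F h => F p h; rewrite (bool_irrelevance h p).
Qed.

Lemma cochain_ext_dim i (c : cochains S i) (F : face Sigma) :
  dim_face F != i -> cochain_ext c F = 0.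
Proof. by rewrite /cochain_ext; case: {-}_ / idP => // h /negP. Qed.

Lemma dim_face_del (G : face Sigma) v i :
  v \in val G -> dim_face G == i + 1 -> dim_face (face_del G v) == i.
Proof.
rewrite /dim_face [val (face_del G v)]/= => vG; rewrite (cardsD1 v (val G)) vG.
by move: #|_| => m; rewrite PoszD [_ + m%:Z]addrC addrK => /eqP->; rewrite addrK.
Qed.

(** Once the two sums are exchanged, each vertex [v] selects the single cell [G :\ v]. The equation
    [j = i + 1] is a hypothesis because [i - 1 + 1] and [i] are not convertible. *)
Lemma coboundaryE i j (c : cochains S i) (G : cell Sigma j) : j = i + 1 ->
  coboundary S i j c G =
  \sum_(v in val (val G)) (-1) ^+ incidence_exp (val (val G)) v *:
     res S (subD1set _ _ : val (face_del (val G) v) \subset val (val G))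
       (cochain_ext c (face_del (val G) v)).
Proof.
move=> ji; rewrite ffunE (exchange_big_dep (mem (val (val G)))) /=; last first.
  by move=> F v _ /andP[].
apply: eq_bigr => v vG.
have dG : dim_face (face_del (val G) v) == i.
  by apply: dim_face_del => //; rewrite -ji; apply: (valP G).
pose F := exist (fun F => dim_face F == i) _ dG : cell Sigma i.
rewrite (big_pred1 F) => [|F' /=]; last by rewrite vG /= -!val_eqE.
congr (_ *: _).
have -> : cochain_ext c (face_del (val G) v) = c F := cochain_extE c F.
rewrite /res_total; case: eqP => [h|[]]; last exact: subD1set.
by congr (res S _ _); apply: bool_irrelevance.
Qed.

End CoboundaryFormula.

Lemma incidence_exp_setU1 (N : nat) (T : {set 'I_N}) (v u : 'I_N) : v \notin T ->
  incidence_exp (v |: T) u = ((v < u)%N + incidence_exp T u)%N.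
Proof.
move=> vT; rewrite /incidence_exp (cardsD1 v) !inE eqxx /=; congr (_ + _)%N.
apply: eq_card => w; rewrite !inE; case: eqVneq => [->|] //=.
by rewrite (negPf vT).
Qed.

(** This is the cancellation behind [d^2 = 0] on the square of [T :\ u], [T], [v |: (T :\ u)] and
    [v |: T]: exactly one of [u < v] and [v < u] holds, and it shifts one exponent by one. *)
Lemma incidence_sign_swap (A : comPzRingType) (N : nat) (T : {set 'I_N}) (v u : 'I_N) :
  v \notin T -> u \in T ->
  (-1) ^+ incidence_exp T u * (-1) ^+ incidence_exp (v |: (T :\ u)) v =
  - ((-1) ^+ incidence_exp (v |: T) v * (-1) ^+ incidence_exp (v |: T) u) :> A.
Proof.
move=> vT uT; have vTu : v \notin T :\ u by rewrite in_setD1 negb_and vT orbT.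
have -> : incidence_exp (v |: T) v = ((u < v)%N + incidence_exp (T :\ u) v)%N.
  rewrite incidence_exp_setU1 // ltnn add0n -{1}(setD1K uT).
  by rewrite incidence_exp_setU1 ?setD11.
rewrite !incidence_exp_setU1 // ltnn add0n !exprD.
have uv : u != v by apply: contraNneq vT => <-.
have -> : (v < u)%N = ~~ (u < v)%N.
  by move: uv; rewrite -val_eqE /=; case: ltngtP.
by case: (u < v)%N => /=; rewrite !expr1 !expr0; ring.
Qed.

Lemma res_cochain_ext (A : comPzRingType) (N : nat) (Sigma : scomplex N)
    (S : cellular_sheaf A Sigma) i (z : cochains S i) (F F' G : face Sigma)
    (h : val F \subset val G) (h' : val F' \subset val G) :
  F = F' -> res S h (cochain_ext z F) = res S h' (cochain_ext z F').
Proof. by move=> FF'; subst F'; congr (res S _ _); apply: bool_irrelevance. Qed.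

Lemma cochain_ext_cell (A : comPzRingType) (N : nat) (Sigma : scomplex N)
    (S : cellular_sheaf A Sigma) i (z : cochains S i) (F : face Sigma)
    (dF : dim_face F == i) :
  cochain_ext z F = z (exist (fun F => dim_face F == i) F dF).
Proof. exact: (cochain_extE z (exist (fun F => dim_face F == i) F dF)). Qed.

Lemma cochain_ext0 (A : comPzRingType) (N : nat) (Sigma : scomplex N)
    (S : cellular_sheaf A Sigma) i (F : face Sigma) :
  cochain_ext (0 : cochains S i) F = 0.
Proof.
have [dF|dF] := boolP (dim_face F == i); last by rewrite cochain_ext_dim.
by rewrite (cochain_ext_cell _ dF) ffunE.
Qed.

Definition full_face (N : nat) (S : {set 'I_N}) : face (full_simplex N) :=
  exist _ S (in_setT S).

Section StablePredicate.
Variables (A : comPzRingType) (N : nat) (Sigma : scomplex N).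
Variables (S : cellular_sheaf A Sigma).
Variable (P : forall F : face Sigma, sections S F -> Prop).
Arguments P {F}.
Hypothesis P0 : forall F, P (0 : sections S F).
Hypothesis PB : forall F (x x' : sections S F), P x -> P x' -> P (x - x').

Lemma stable_sign F e (x : sections S F) : P x -> P ((-1) ^+ e *: x).
Proof.
move=> Px; rewrite -signr_odd; case: odd => /=; last by rewrite scale1r.
by rewrite scaleN1r -[- x]add0r; apply: PB.
Qed.

Lemma stable_sum F (I : finType) (B : {set I}) (x : I -> sections S F) :
  (forall u, u \in B -> P (x u)) -> P (\sum_(u in B) x u).
Proof.
move=> Px; apply: (big_ind (fun x => P x)) => // y z Py Pz.
by rewrite -[z]opprK -[- z]add0r; apply: PB => //; apply: PB.
Qed.

(** In the application, [P] is homogeneity of a fixed degree. *)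
Definition cochain_in i (z : cochains S i) : Prop :=
  forall T : cell Sigma i, P (z T).

Lemma cochain_in_ext i (z : cochains S i) E : cochain_in z -> P (cochain_ext z E).
Proof.
move=> Pz; have [dE|dE] := boolP (dim_face E == i).
  by rewrite (cochain_ext_cell _ dE); apply: (Pz (exist _ E dE)).
by rewrite cochain_ext_dim.
Qed.

Hypothesis P_res : forall (F G : face Sigma) (h : val F \subset val G) x,
  P x -> P (res S h x).

Lemma cochain_in_coboundary i j (z : cochains S i) : j = i + 1 ->
  cochain_in z -> cochain_in (coboundary S i j z).
Proof.
move=> ij Pz T; rewrite coboundaryE //; apply: stable_sum => v _.
exact/stable_sign/P_res/cochain_in_ext.
Qed.

End StablePredicate.

(** * Cones and links *)

Section ConeVertex.
Variables (A : comPzRingType) (N : nat) (S : cellular_sheaf A (full_simplex N)).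
Variable (P : forall F : face (full_simplex N), sections S F -> Prop).
Arguments P {F}.
Hypothesis P0 : forall F, P (0 : sections S F).
Hypothesis PB : forall F (x x' : sections S F), P x -> P x' -> P (x - x').
Hypothesis P_res : forall (F G : face (full_simplex N)) (h : val F \subset val G) x,
  P x -> P (res S h x).
Variable v : 'I_N.
Hypothesis res_inj : forall (F G : face (full_simplex N)) (h : val F \subset val G) x,
  val G = v |: val F -> P x -> res S h x = 0 -> x = 0.
Hypothesis res_surj : forall (F G : face (full_simplex N)) (h : val F \subset val G) x',
  val G = v |: val F -> P x' -> exists x, P x /\ res S h x = x'.

(* The inverses of the restriction maps from F to v |: F form a contracting
   homotopy. *)
Lemma cone_coboundary i (z : cochains S i) :
  coboundary S i (i + 1) z = 0 -> cochain_in (@P) z ->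
  exists w, z = coboundary S (i - 1) i w.
Proof.
move=> dz Pz.
have Pze F : P (cochain_ext z F) by apply: (cochain_in_ext P0).
(* Quantifying over all [G] with underlying set [v |: F] avoids transporting sections along
   equalities of faces. *)
have H (F : face (full_simplex N)) : exists x : sections S F, v \notin val F ->
    P x /\ forall (G : face (full_simplex N)) (h : val F \subset val G),
      val G = v |: val F -> res S h x = cochain_ext z G.
  have [vF|vF] := boolP (v \in val F); first by exists 0.
  have h0 : val F \subset val (full_face (v |: val F)) := subsetUr _ _.
  have [x [Px rx]] := res_surj h0 erefl (Pze (full_face (v |: val F))).
  exists x => _; split=> // G h GF.
  have {GF} GE : full_face (v |: val F) = G by apply: val_inj.
  by subst G; rewrite -rx; congr (res S _ _); apply: bool_irrelevance.
pose w0 F := sval (cid (H F)).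
have w0P (F : face (full_simplex N)) : v \notin val F -> P (w0 F) /\
    forall (G : face (full_simplex N)) (h : val F \subset val G),
      val G = v |: val F -> res S h (w0 F) = cochain_ext z G := svalP (cid (H F)).
(* The contraction of [z]: zero on faces through [v], and elsewhere the preimage of [z] at [v |: F]
   with the incidence sign of [v]. *)
pose w : cochains S (i - 1) := [ffun F : cell (full_simplex N) (i - 1) =>
  if v \in val (val F) then 0
  else (-1) ^+ incidence_exp (v |: val (val F)) v *: w0 (val F)
  : sections S (val F)].
have wE (F : face (full_simplex N)) : dim_face F == i - 1 -> cochain_ext w F =
    if v \in val F then 0 else (-1) ^+ incidence_exp (v |: val F) v *: w0 F.
  by move=> dF; rewrite (cochain_ext_cell _ dF) ffunE.
have Pw F : P (cochain_ext w F).
  have [dF|dF] := boolP (dim_face F == i - 1); last by rewrite cochain_ext_dim.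
  rewrite wE //; case: ifPn => // vF.
  exact/(stable_sign P0 PB)/(w0P _ vF).1.
exists w; apply/ffunP => T; rewrite coboundaryE ?subrK //.
have dT : dim_face (val T) == i - 1 + 1 by rewrite subrK; apply: (valP T).
have dTu u : u \in val (val T) -> dim_face (face_del (val T) u) == i - 1.
  by move=> uT; apply: dim_face_del.
have [vT|vT] := boolP (v \in val (val T)).
  (* For [v] in [T], every [T :\ u] with [u != v] contains [v], so only the term of [v] survives,
     and its sign is squared. *)
  rewrite (bigD1 v) //= big1 ?addr0 => [|u /andP[uT uv]]; last first.
    by rewrite wE ?dTu // in_setD1 eq_sym uv vT linear0 scaler0.
  have vTv : v \notin val (val T) :\ v by rewrite setD11.
  rewrite wE ?dTu // (negPf vTv) linearZ /= scalerA setD1K // -expr2 sqrr_sign.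
  have [_ ->] := w0P (face_del (val T) v) vTv; last by rewrite /= setD1K.
  by rewrite scale1r cochain_extE.
(* For [v] outside [T], both sides are compared after restriction to [U], which is injective on [P];
   the cocycle condition of [z] at [U] then gives the equality. *)
pose U := full_face (v |: val (val T)).
have dU : dim_face U == i + 1.
  move: dT; rewrite subrK /dim_face /= cardsU1 vT add1n -addn1 PoszD.
  by move: #|_| => m /eqP <-; rewrite addrAC.
have hTU : val (val T) \subset val U := subsetUr _ _.
have vU : v \in val U := setU11 _ _.
set dw := (X in _ = X).
have Pdw : P dw by apply: (stable_sum P0 PB) => u _; apply/(stable_sign P0 PB)/P_res.
apply/eqP; rewrite -subr_eq0; apply/eqP.
apply: (res_inj (h := hTU)) => //; first exact: PB.
pose hU u : val (face_del U u) \subset val U := subD1set _ _.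
pose X u := res S (hU u) (cochain_ext z (face_del U u)).
have resw u : u \in val (val T) ->
    res S hTU (res S (subD1set _ _ : val (face_del (val T) u) \subset val (val T))
      (cochain_ext w (face_del (val T) u))) =
    (-1) ^+ incidence_exp (v |: (val (val T) :\ u)) v *: X u.
  move=> uT; rewrite wE ?dTu // in_setD1 (negPf vT) andbF !linearZ; congr (_ *: _).
  have uv : u != v by apply: contraNneq vT => <-.
  have vTu : v \notin val (face_del (val T) u) by rewrite /= in_setD1 (negPf vT) andbF.
  have hTu : val (face_del (val T) u) \subset val (face_del U u).
    by apply: setSD.
  have hTuU : val (face_del (val T) u) \subset val U.
    by apply: subset_trans hTu (subD1set _ _).
  rewrite -(res_comp _ _ hTuU) (res_comp hTu (hU u)); congr (res S _ _).
  apply: (w0P _ vTu).2; apply/setP => x; rewrite /= !inE.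
  by case: eqVneq => [->|] //=; rewrite (negPf uv).
have Xv : X v = res S hTU (z T).
  rewrite -cochain_extE; apply: res_cochain_ext.
  by apply: val_inj; rewrite /= setU1K.
have dzU : \sum_(u in v |: val (val T)) (-1) ^+ incidence_exp (val U) u *: X u = 0.
  have := congr1 (fun c : cochains S (i + 1) =>
    c (exist (fun F => dim_face F == i + 1) U dU)) dz.
  by rewrite coboundaryE // ffunE.
have zU : (-1) ^+ incidence_exp (val U) v *: res S hTU (z T) =
    - \sum_(u in val (val T)) (-1) ^+ incidence_exp (val U) u *: X u.
  by apply/eqP; rewrite -addr_eq0 -Xv; apply/eqP; move: dzU; rewrite big_setU1.
rewrite linearB /=; apply/eqP; rewrite subr_eq0; apply/eqP.
rewrite -[LHS]scale1r -(sqrr_sign _ (incidence_exp (val U) v)) expr2 -scalerA.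
rewrite [X in _ *: X]zU -sumrN scaler_sumr linear_sum; apply: eq_bigr => u uT.
rewrite [in RHS]linearZ /= (resw u uT) scalerN !scalerA -scaleNr; congr (_ *: _).
exact: (esym (incidence_sign_swap _ vT uT)).
Qed.

End ConeVertex.

(** * Comparison with a sheaf on a link *)

Section LinkComparison.
Variables (A B : comPzRingType) (phi : {rmorphism A -> B}) (N : nat).
Variables (G : {set 'I_N}) (Lambda : scomplex N).
Hypothesis G_disjoint : forall F, F \in Lambda -> [disjoint G & F].
Variables (S : cellular_sheaf B (full_simplex N)) (D : cellular_sheaf A Lambda).
Variable (P : forall F : face (full_simplex N), sections S F -> Prop).
Arguments P {F}.
Hypothesis P0 : forall F, P (0 : sections S F).
Hypothesis PB : forall F (x x' : sections S F), P x -> P x' -> P (x - x').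
Hypothesis P_res : forall (F F' : face (full_simplex N)) (h : val F \subset val F') x,
  P x -> P (res S h x).
Local Notation join F := (full_face (G :|: F)).
Variable comp : forall F : face Lambda, sections S (join (val F)) -> sections D F.
Arguments comp {F}.
Hypothesis compP : forall F c (x x' : sections S (join (val F))),
  comp (phi c *: x + x') = c *: comp x + comp x'.
Hypothesis comp_res : forall (F F' : face Lambda) (h : val F \subset val F')
  (h' : val (join (val F)) \subset val (join (val F'))) x,
  comp (res S h' x) = res D h (comp x).
Hypothesis comp_res0 : forall (E : face (full_simplex N)) (F : face Lambda)
  (h : val E \subset val (join (val F))) x, ~~ (G \subset val E) -> comp (res S h x) = 0.
Hypothesis comp_inj : forall (F : face Lambda) (x : sections S (join (val F))),
  P x -> comp x = 0 -> x = 0.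
Hypothesis comp_surj : forall (F : face Lambda) (u : sections D F),
  exists x : sections S (join (val F)), P x /\ comp x = u.
Hypothesis P_outside : forall (E : face (full_simplex N)) (x : sections S E),
  (forall F : face Lambda, val E <> G :|: val F) -> P x -> x = 0.

Lemma comp0 (F : face Lambda) : comp (0 : sections S (join (val F))) = 0.
Proof.
have := compP 1 0 (0 : sections S (join (val F))).
by rewrite scaler0 addr0 scale1r -[LHS]addr0 => /addrI/esym.
Qed.

Lemma comp_sign (F : face Lambda) e (x : sections S (join (val F))) :
  comp ((-1) ^+ e *: x) = (-1) ^+ e *: comp x.
Proof. by have := compP ((-1) ^+ e) x 0; rewrite comp0 !addr0 rmorphXn rmorphN1. Qed.

Lemma comp_sum (F : face Lambda) (I : Type) (r : seq I) (Q : pred I)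
    (x : I -> sections S (join (val F))) :
  comp (\sum_(v <- r | Q v) x v) = \sum_(v <- r | Q v) comp (x v).
Proof.
apply: big_morph; last exact: comp0.
by move=> u v; have := compP 1 u v; rewrite rmorph1 !scale1r.
Qed.

(* (-1) ^+ twist F is the sign of the shuffle of G and F. *)
Definition twist (F : {set 'I_N}) : nat := (\sum_(v in F) incidence_exp G v)%N.

(** As [G] and [F] are disjoint, the position of [v] in [G :|: F] is the sum of its counts in [G]
    and in [F]. The count in [G] is also what [twist] loses when [v] is deleted, so it occurs twice
    and cancels. *)
Lemma twist_sign (F : {set 'I_N}) v : [disjoint G & F] -> v \in F ->
  (-1) ^+ twist F * (-1) ^+ incidence_exp (G :|: F) v =
  (-1) ^+ incidence_exp F v * (-1) ^+ twist (F :\ v) :> A.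
Proof.
move=> GF vF; rewrite /twist (big_setD1 v) //=.
have -> : incidence_exp (G :|: F) v = (incidence_exp G v + incidence_exp F v)%N.
  rewrite /incidence_exp -cardsUI -[LHS]addn0; congr (_ + _)%N.
    by apply: eq_card => w; rewrite !inE andb_orl.
  apply/esym/eqP; rewrite cards_eq0 -subset0; apply/subsetP => w; rewrite !inE.
  move=> /andP[/andP[wG _] /andP[wF _]].
  by have := disjointFr GF wG; rewrite wF.
rewrite !exprD; set g := _ ^+ incidence_exp G v.
have gg : g * g = 1 by rewrite -expr2 sqrr_sign.
by rewrite mulrACA gg mul1r mulrC.
Qed.

(** The degree [i'] is a separate parameter, tied to [i - #|G|] by an equation in the lemmas that
    need it. *)
Definition link_map i i' (z : cochains S i) : cochains D i' :=
  [ffun F : cell Lambda i' =>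
    (-1) ^+ twist (val (val F)) *:
      comp (cochain_ext z (join (val (val F)))) : sections D (val F)].

Lemma dim_join (F : face Lambda) : dim_face (join (val F)) = dim_face F + #|G|%:Z.
Proof.
rewrite /dim_face [val (join _)]/= cardsU.
have := G_disjoint (valP F); rewrite -setI_eq0 => /eqP ->.
by rewrite cards0 subn0 addnC PoszD addrAC.
Qed.

Lemma link_map_ext i i' (z : cochains S i) (F : face Lambda) : i' = i - #|G|%:Z ->
  cochain_ext (link_map i' z) F =
  (-1) ^+ twist (val F) *: comp (cochain_ext z (join (val F))).
Proof.
move=> ii'; have [dF|dF] := boolP (dim_face F == i').
  by rewrite (cochain_ext_cell _ dF) ffunE.
rewrite !cochain_ext_dim //; first by rewrite comp0 scaler0.
by rewrite dim_join; apply: contra dF => /eqP e; rewrite ii' -e addrK.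
Qed.

(** In the coboundary at [G :|: F], deleting a vertex of [G] leaves a face not containing [G], and
    [comp_res0] kills that term. The terms deleting a vertex of [F] match by [twist_sign]. *)
Lemma link_map_coboundary i i' j j' (z : cochains S i) :
  i' = i - #|G|%:Z -> j = i + 1 -> j' = i' + 1 ->
  link_map j' (coboundary S i j z) = coboundary D i' j' (link_map i' z).
Proof.
move=> ii' ij ij'; apply/ffunP => F; rewrite ffunE coboundaryE //.
have FL := valP (val F); have GF := G_disjoint FL.
have dF : dim_face (join (val (val F))) == j.
  by rewrite dim_join (eqP (valP F)) ij' ii' ij addrAC subrK.
pose J := join (val (val F)).
have -> : cochain_ext (coboundary S i j z) J =
    \sum_(v in G :|: val (val F)) (-1) ^+ incidence_exp (G :|: val (val F)) v *:
      res S (subD1set _ _ : val (face_del J v) \subset val J)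
        (cochain_ext z (face_del J v)).
  by rewrite (cochain_ext_cell _ dF) coboundaryE.
rewrite comp_sum (bigID (mem G)) /= big1 ?add0r => [|v /andP[_ vG]]; last first.
  rewrite comp_sign comp_res0 ?scaler0 //; apply/subsetPn; exists v => //.
  by rewrite setD11.
rewrite (eq_bigl (mem (val (val F)))) => [|v]; last first.
  rewrite in_setU /=; case: (boolP (v \in G)) => vG; last by rewrite andbT.
  by rewrite andbF (disjointFr GF vG).
rewrite scaler_sumr; apply: eq_bigr => v vF.
rewrite link_map_ext // linearZ comp_sign !scalerA (twist_sign GF vF); congr (_ *: _).
have vG : v \in G = false by have := disjointFl GF vF.
have hj : val (join (val (face_del (val F) v))) \subset val (join (val (val F))).
  by rewrite setUS // subD1set.
rewrite -(comp_res _ hj); congr comp; apply: res_cochain_ext.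
apply: val_inj; apply/setP => w; rewrite !inE.
by case: eqVneq => [->|] //=; rewrite vG.
Qed.

Lemma link_mapP i i' c (z z' : cochains S i) :
  link_map i' (phi c *: z + z') = c *: link_map i' z + link_map i' z'.
Proof.
apply/ffunP => F; rewrite !ffunE.
have -> E : cochain_ext (phi c *: z + z') E = phi c *: cochain_ext z E + cochain_ext z' E.
  have [dE|dE] := boolP (dim_face E == i).
    by rewrite !(cochain_ext_cell _ dE) !ffunE.
  by rewrite !cochain_ext_dim // scaler0 addr0.
by rewrite compP scalerDr !scalerA mulrC.
Qed.

Lemma link_map_inj i i' (z : cochains S i) : i' = i - #|G|%:Z ->
  cochain_in (@P) z -> link_map i' z = 0 -> z = 0.
Proof.
move=> ii' Pz z0; apply/ffunP => T; rewrite ffunE.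
(* By [P_outside] only the faces [T = G :|: F] remain, and there [comp] is injective on [P]. *)
apply: contrapT => zT; apply: (zT); apply: P_outside (Pz T) => F TF; apply: zT.
have TE : join (val F) = val T by apply: val_inj.
rewrite -cochain_extE -TE; apply: comp_inj; first exact: (cochain_in_ext P0).
have := link_map_ext z F ii'; rewrite z0 cochain_ext0.
move=> /esym/(congr1 ( *:%R ((-1) ^+ twist (val F)))).
by rewrite scaler0 scalerA -expr2 sqrr_sign scale1r.
Qed.

Lemma link_map_surj i i' (c : cochains D i') : i' = i - #|G|%:Z ->
  exists2 z : cochains S i, cochain_in (@P) z & c = link_map i' z.
Proof.
move=> ii'.
(* The preimage is chosen face by face. If [E = G :|: F], disjointness makes [F] unique, so the
   condition concerns one [F] only; otherwise zero serves. *)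
have H (E : face (full_simplex N)) : exists x : sections S E, P x /\
    forall (F : face Lambda) (FE : join (val F) = E),
      comp (ecast E (sections S E) (esym FE) x) = (-1) ^+ twist (val F) *: cochain_ext c F.
  have [[F FE]|nE] := pselect (exists F : face Lambda, join (val F) = E).
    have [x [Px cx]] := comp_surj ((-1) ^+ twist (val F) *: cochain_ext c F).
    subst E; exists x; split=> // F' FE'.
    have FF' : F' = F.
      apply: val_inj; have GF := G_disjoint (valP F); have GF' := G_disjoint (valP F').
      have := congr1 (fun E => val E :\: G) FE'; rewrite /= !setDUl !setDv !set0U.
      by rewrite !(setDidPl _) // disjoint_sym.
    by subst F'; rewrite (Prop_irrelevance FE' erefl).
  by exists 0; split=> // F FE; case: nE; exists F.
pose z : cochains S i :=
  [ffun T : cell (full_simplex N) i => sval (cid (H (val T))) : sections S (val T)].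
have Pz : cochain_in (@P) z by move=> T; rewrite ffunE; apply: (svalP (cid (H (val T)))).1.
exists z => //; apply/ffunP => F; rewrite ffunE.
have dF : dim_face (join (val (val F))) == i.
  by rewrite dim_join (eqP (valP F)) ii' subrK.
rewrite (cochain_ext_cell _ dF) ffunE.
have -> : comp (sval (cid (H (join (val (val F)))))) =
    (-1) ^+ twist (val (val F)) *: cochain_ext c (val F).
  exact: ((svalP (cid (H (join (val (val F)))))).2 (val F) erefl).
by rewrite scalerA -expr2 sqrr_sign scale1r cochain_extE.
Qed.

Lemma link_cohomology_iso i (W : submodule (restr phi (cohomology S i))) :
  (forall u : cohomology S i, u \in W <->
     exists2 z, u = quot_class (boundaries _ _) z & cochain_in (@P) (val z)) ->
  isomorphic (submod_type W : lmodType A) (cohomology D (i - #|G|%:Z)).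
Proof.
move=> W_mem; set i' := i - #|G|%:Z.
have ii' : i' - 1 = i - 1 - #|G|%:Z by rewrite addrAC.
have ii'' : i' + 1 = i + 1 - #|G|%:Z by rewrite addrAC.
apply: (@homogeneous_homology_iso _ _ _ _ _ _ _ _ _ _ _ _ _
  (@link_map (i - 1) (i' - 1)) (@link_map i i') (@link_map (i + 1) (i' + 1))
  (fun z : cochains S (i - 1) => cochain_in (@P) z)
  (fun z : cochains S i => cochain_in (@P) z)
  (fun z : cochains S (i + 1) => cochain_in (@P) z)) => //.
- exact: link_mapP.
- by apply/ffunP => F; rewrite !ffunE cochain_ext0 comp0 scaler0.
- by move=> z; apply: link_map_coboundary; rewrite ?subrK.
- by move=> z; apply: link_map_coboundary.
- by move=> z z' Pz Pz' T; rewrite !ffunE; apply: PB.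
- by move=> z; apply: (cochain_in_coboundary P0 PB P_res); rewrite subrK.
- by move=> z; apply: (cochain_in_coboundary P0 PB P_res).
- by move=> z; apply: link_map_inj.
- by move=> z; apply: link_map_inj.
- by move=> c; apply: link_map_surj.
- by move=> c; apply: link_map_surj.
Qed.

End LinkComparison.

(** * Coefficients at integer exponents *)

Section Coefficients.
Variables (V : nzRingType) (n : nat).
Implicit Types (p q : {mpoly V[n]}) (m : 'X_{1..n}) (b : 'I_n -> int).

Lemma mcoeffXM p m m' :
  ('X_[m] * p)@_m' = if (m <= m')%MM then p@_(m' - m) else 0.
Proof.
rewrite -commr_mpolyX; case: ifPn => [/submK {1}<-|mm'].
  by rewrite addmC mcoeffMX.
apply/eqP; rewrite mcoeff_eq0 (perm_mem (msuppMX p m)).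
by apply: contra mm' => /mapP[m2 _ ->]; rewrite lem_addr.
Qed.

Definition nat_exponent b : 'X_{1..n} := [multinom `|b j|%N | j < n].

(** The degree [a + k deg y_S] may have negative entries. Setting the coefficient to zero there lets
    [zcoefXM] hold for every integer exponent. *)
Definition zcoef b p : V :=
  if [forall j, 0 <= b j] then p@_(nat_exponent b) else 0.

Lemma zcoefP b : linear_for *%R (zcoef b).
Proof.
move=> a p q; rewrite /zcoef; case: ifP => _; last by rewrite mulr0 addr0.
by rewrite mcoeffD mcoeffZ.
Qed.

Lemma zcoef0 b : zcoef b 0 = 0.
Proof. by rewrite /zcoef mcoeff0 if_same. Qed.

Lemma zcoefD b p q : zcoef b (p + q) = zcoef b p + zcoef b q.
Proof. by have := zcoefP b 1 p q; rewrite scale1r mul1r. Qed.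

Lemma zcoefZ b c p : zcoef b (c *: p) = c * zcoef b p.
Proof. by have := zcoefP b c p 0; rewrite !addr0 zcoef0 addr0. Qed.

Lemma zcoefB b p q : zcoef b (p - q) = zcoef b p - zcoef b q.
Proof. by rewrite -scaleN1r zcoefD zcoefZ mulN1r. Qed.

Lemma eq_zcoef b b' p : b =1 b' -> zcoef b p = zcoef b' p.
Proof. by move=> /funext->. Qed.

Lemma zcoef_neg b p j : b j < 0 -> zcoef b p = 0.
Proof.
by move=> bj; rewrite /zcoef; case: forallP => // /(_ j); rewrite leNgt bj.
Qed.

Lemma zcoefXM b m p : zcoef (fun j => b j + (m j)%:Z) ('X_[m] * p) = zcoef b p.
Proof.
have [[j bj]|b0] := altP (@existsP _ (fun j => b j < 0)).
  (* Even where [b j + m j] is nonnegative it is less than [m j], so this exponent does not occur in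
     a multiple of ['X_[m]]. *)
  rewrite (zcoef_neg p bj) /zcoef; case: forallP => // bm0.
  rewrite mcoeffXM; case: ifP => // /mnm_lepP/(_ j).
  by have := bm0 j; rewrite mnmE; lia.
have {}b0 j : 0 <= b j.
  by rewrite leNgt; apply: contra b0 => bj; apply/existsP; exists j.
rewrite /zcoef; have -> : [forall j, 0 <= b j] by apply/forallP.
have -> : [forall j, 0 <= b j + (m j)%:Z].
  by apply/forallP => j; rewrite addr_ge0.
rewrite mcoeffXM ifT; last first.
  by apply/mnm_lepP => j; rewrite mnmE; have := b0 j; lia.
congr (_@_ _); apply/mnmP => j; rewrite !mnmE; have := b0 j; lia.
Qed.

Definition zterm b p : {mpoly V[n]} := zcoef b p *: 'X_[nat_exponent b].

Lemma zterm_supp b p m : m \in msupp (zterm b p) -> forall j, (m j)%:Z = b j.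
Proof.
rewrite /zterm /zcoef; case: forallP => [b0|_]; last by rewrite scale0r msupp0.
by move=> /msuppZ_le; rewrite msuppX inE => /eqP-> j; rewrite mnmE gez0_abs.
Qed.

Lemma zterm_homog b p : (forall m, m \in msupp p -> forall j, (m j)%:Z = b j) ->
  p = zterm b p.
Proof.
move=> hp; apply/mpolyP => m; rewrite mcoeffZ mcoeffX.
have [mp|mp] := boolP (m \in msupp p).
  have -> : nat_exponent b = m by apply/mnmP => j; rewrite mnmE -(hp _ mp).
  rewrite eqxx mulr1 /zcoef; have -> : [forall j, 0 <= b j].
    by apply/forallP => j; rewrite -(hp _ mp).
  by congr (_@_ _); apply/mnmP => j; rewrite mnmE -(hp _ mp).
rewrite memN_msupp_eq0 //; have [bm|] := eqVneq (nat_exponent b) m; last first.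
  by rewrite mulr0.
by rewrite mulr1 /zcoef bm memN_msupp_eq0 ?if_same.
Qed.

Lemma mcoeff_zterm b p m :
  (zterm b p)@_m = if [forall j, b j == (m j)%:Z] then p@_m else 0.
Proof.
case: forallP => [bm|bm]; last first.
  rewrite memN_msupp_eq0 //; apply/negP => /zterm_supp mb; apply: bm => j.
  by rewrite mb.
rewrite /zterm /zcoef ifT; last by apply/forallP => j; rewrite (eqP (bm j)).
rewrite mcoeffZ mcoeffX; have -> : nat_exponent b = m.
  by apply/mnmP => j; rewrite mnmE (eqP (bm j)).
by rewrite eqxx mulr1.
Qed.

Lemma zcoef_zterm b b' p :
  zcoef b (zterm b' p) = if [forall j, b' j == b j] then zcoef b p else 0.
Proof.
rewrite [LHS]/zcoef mcoeff_zterm /zcoef; case: ifP => [/forallP b0|b0].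
  by congr (if _ then _ else _); apply: eq_forallb => j; rewrite mnmE gez0_abs.
by rewrite if_same.
Qed.

End Coefficients.

(** * The t-Stanley-Reisner ideal *)

Section Support.
Variable n : nat.
Implicit Types (S : {set 'I_n.+1}) (b : 'I_n -> int).

Definition pos_support b : {set 'I_n.+1} := [set lift ord0 j | j : 'I_n & 0 < b j].

Lemma mem_pos_support b j : (lift ord0 j \in pos_support b) = (0 < b j).
Proof. by rewrite mem_imset ?inE //; apply: lift_inj. Qed.

Lemma ord0_pos_support b : (ord0 \in pos_support b) = false.
Proof. by apply/imsetP => -[j _ /eqP]; rewrite (negPf (neq_lift _ _)). Qed.

Lemma mem_neg_support b j : (lift ord0 j \in neg_support b) = (b j < 0).
Proof. by rewrite mem_imset ?inE //; apply: lift_inj. Qed.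

Lemma ord0_neg_support b : (ord0 \in neg_support b) = false.
Proof. by apply/imsetP => -[j _ /eqP]; rewrite (negPf (neq_lift _ _)). Qed.

Definition mnm_support (m : 'X_{1..n}) := pos_support (fun j => (m j)%:Z).

(** The exponent of the squarefree monomial of [S]; the factor [t] of [v_0] is recorded by
    [tcoef]. *)
Definition set_mnm S : 'X_{1..n} := [multinom (lift ord0 j \in S : nat) | j < n].

End Support.

Lemma spanE (A : pzRingType) (M : lmodType A) (S : M -> Prop) (x : M) :
  x \in Defs.span S <-> in_span S x.
Proof. exact: (submodule_ofE (@in_span0 _ _ S) (@in_spanD _ _ S)). Qed.

Section SRIdeal.
Variables (V : idomainType) (t : V) (n : nat) (Delta : scomplex n.+1).
Implicit Types (S : {set 'I_n.+1}) (p : {mpoly V[n]}).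

Definition tcoef S : V := if ord0 \in S then t else 1.

Lemma SR_var_prod S : \prod_(i in S) SR_var t i = tcoef S *: 'X_[set_mnm S].
Proof.
rewrite big_mkcond big_ord_recl mpolyXE_id /tcoef -mul_mpolyC.
congr (_ * _) => [|].
  by case: ifP => // _; rewrite /SR_var unlift_none.
apply: eq_bigr => j _; rewrite mnmE /SR_var liftK.
by case: ifP => _; rewrite ?expr1 ?expr0.
Qed.

Lemma SR_class_eq0 p : SR_class t Delta p = 0 <-> p \in SR_ideal t Delta.
Proof. by rewrite -(rmorph0 (SR_class t Delta)) ring_class_eq subr0. Qed.

Lemma SR_class_nonface S : S \notin Delta ->
  SR_class t Delta (\prod_(i in S) SR_var t i) = 0.
Proof.
by move=> SD; apply/SR_class_eq0/spanE => N; apply; exists S.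
Qed.

(** The two conditions, required for all [m], cut out an ideal of polynomials, and this ideal
    contains the generators. *)
Lemma SR_coef_mem p m : SR_class t Delta p = 0 ->
  (mnm_support m \in Delta -> exists c, p@_m = t * c) /\
  (ord0 |: mnm_support m \in Delta -> p@_m = 0).
Proof.
pose Q p := forall m,
  (mnm_support m \in Delta -> exists c, p@_m = t * c) /\
  (ord0 |: mnm_support m \in Delta -> p@_m = 0).
move=> p0; suff: Q p by apply.
have Q0 : Q 0.
  by move=> m'; rewrite mcoeff0; split=> // _; exists 0; rewrite mulr0.
have QD (q r s : {mpoly V[n]}^o) : Q r -> Q s -> Q (q *: r + s).
  move=> Qr Qs m'; rewrite mcoeffD mcoeffM.
  (* Supports only grow under multiplication, so the face conditions pass from [m'] to [k.2]. *)
  have sub (k : 'X_{1..n < (mdeg m').+1, (mdeg m').+1}) :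
      (m' == k.1 + k.2)%MM -> mnm_support k.2 \subset mnm_support m'.
    move=> /eqP mk; apply/subsetP => _ /imsetP[j + ->]; rewrite inE.
    have := congr1 (fun m : 'X_{1..n} => m j) mk; rewrite !mem_pos_support mnmDE /=.
    by lia.
  split=> mD.
    have [c ->] := (Qs m').1 mD.
    suff [c' ->] : exists c', \sum_(k : 'X_{1..n < (mdeg m').+1, (mdeg m').+1} |
        m' == (k.1 + k.2)%MM) (q@_k.1 * r@_k.2) = t * c'.
      by exists (c' + c); rewrite mulrDr.
    apply: (big_ind (fun x => exists c', x = t * c')).
    - by exists 0; rewrite mulr0.
    - by move=> _ _ [x ->] [y ->]; exists (x + y); rewrite mulrDr.
    - move=> k mk; have [|x ->] := (Qr k.2).1; first exact: faces_sub mD (sub k mk).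
      by exists (q@_k.1 * x); rewrite mulrCA.
  rewrite (Qs m').2 // addr0 big1 // => k mk; rewrite (Qr k.2).2 ?mulr0 //.
  by apply: faces_sub mD _; apply/setUS/sub.
pose N := @submodule_of {mpoly V[n]} {mpoly V[n]}^o Q Q0 QD.
have NE q : q \in N <-> Q q := @submodule_ofE _ {mpoly V[n]}^o _ Q0 QD q.
have /spanE/(_ N) := (SR_class_eq0 p).1 p0; rewrite NE.
apply=> _ [F FD ->]; apply/NE => m'; rewrite SR_var_prod mcoeffZ mcoeffX.
have [Fm|_] := eqVneq (set_mnm F) m'; last first.
  by rewrite mulr0; split=> // _; exists 0; rewrite mulr0.
(* The nonface [F] lies in [v_0] joined with the support of [m'], and in the support itself if [v_0]
   is not in [F]. The only case without contradiction is [v_0] in [F] with coefficient [t]. *)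
have FS : F \subset ord0 |: mnm_support m'.
  apply/subsetP => i iF; rewrite 2!inE; case: (unliftP ord0 i) iF => [j|] -> //.
  by rewrite mem_pos_support -Fm mnmE => ->; rewrite orbT.
rewrite mulr1 /tcoef; case: ifPn => F0; split=> mD.
- by exists 1; rewrite mulr1.
- by case/negP: FD; apply: faces_sub mD FS.
- case/negP: FD; apply: faces_sub mD _; apply/subsetP => i iF.
  have := subsetP FS i iF; rewrite !inE => /orP[/eqP i0|//].
  by rewrite -i0 iF in F0.
- by case/negP: FD; apply: faces_sub mD FS.
Qed.

(** The monomial is a multiple of the generator attached to [U]. The truncated subtraction of
    exponents is exact, and [t] enters equally on both sides because [mnm_support m] omits [v_0]. *)
Lemma SR_monomial_nonface S m : S :|: mnm_support m \notin Delta ->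
  SR_class t Delta ((\prod_(i in S) SR_var t i) * 'X_[m]) = 0.
Proof.
move=> SmD; set U := S :|: mnm_support m in SmD.
have -> : (\prod_(i in S) SR_var t i) * 'X_[m] =
    'X_[m + set_mnm S - set_mnm U] * \prod_(i in U) SR_var t i.
  rewrite !SR_var_prod -scalerAl -scalerAr -!mpolyXD.
  have -> : tcoef U = tcoef S by rewrite /tcoef in_setU ord0_pos_support orbF.
  congr (_ *: 'X_[_]); apply/mnmP => j; rewrite !mnmE inE mem_pos_support.
  by case: (_ \in S); case: (m j) => [|k] //=; lia.
by rewrite rmorphM SR_class_nonface // mulr0.
Qed.

End SRIdeal.

(** * Homogeneous components of the localizations *)

Section DvrFactorization.
Variables (V : idomainType) (t : V).
Hypothesis V_dvr : is_dvr t.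

Lemma dvr_uniformizer_nunit c : t * c != 1.
Proof.
have [_ nunit _] := V_dvr; apply/eqP => tc1.
have /negP[] : t \isn't a GRing.unit by apply/nunit; exists 1; rewrite mulr1.
by apply/unitrPr; exists c.
Qed.

(* Otherwise v would be divisible by all t ^ e, and a generator of the ideal of
   all x such that some t ^ e * x is a multiple of v would be divisible by itself
   times t. *)
Lemma dvr_not_infinitely_divisible (v : V) : v != 0 ->
  exists e, forall c, v != t ^+ e * c.
Proof.
have [t_neq0 _ pid] := V_dvr; move=> v0; apply: contrapT => hv.
have {}hv e : exists c, v = t ^+ e * c.
  by apply: contrapT => he; apply: hv; exists e => c; apply/eqP => vc; apply: he; exists c.
pose Q x := exists e c, t ^+ e * x = c * v.
have Q0 : Q 0 by exists 0, 0; rewrite mulr0 mul0r.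
have QD (a x z : V^o) : Q x -> Q z -> Q (a *: x + z).
  move=> [e [c ex]] [f [d fz]]; exists (e + f)%N, (a * t ^+ f * c + t ^+ e * d).
  rewrite exprD mulrDr mulrDl -!mulrA -ex -fz /GRing.scale /=.
  by move: a x z ex fz => /= a x z _ _; ring.
have [g gP] := pid (@submodule_of V V^o Q Q0 QD).
have gE x : Q x <-> exists z, x = z * g.
  by rewrite -gP; apply: iff_sym; apply: (@submodule_ofE V V^o Q Q0 QD).
have [e [c ec]] : Q g by apply/gE; exists 1; rewrite mul1r.
have [d vd] := hv e.+1.
have [z dz] : exists z, d = z * g.
  by apply/gE; exists e.+1, 1; rewrite mul1r -vd.
have te0 : t ^+ e != 0 by rewrite expf_neq0.
have g0 : g != 0.
  by apply: contraNneq v0 => g0; rewrite vd dz g0 !mulr0.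
(* From [t ^+ e * g = c * v] and [v = t ^+ e.+1 * (z * g)], cancelling [t ^+ e] and [g] leaves
   [t * (c * z) = 1]. *)
have /negP[] := dvr_uniformizer_nunit (c * z); apply/eqP.
apply: (mulIf g0); apply: (mulfI te0); rewrite mul1r ec vd dz exprS.
by ring.
Qed.

(** Dividing a nonunit by [t] lowers by one the power of [t] known not to divide it, so the division
    stops at a unit. *)
Lemma dvr_factor (v : V) : v != 0 ->
  exists e u, u \is a GRing.unit /\ v = t ^+ e * u.
Proof.
move=> /dvr_not_infinitely_divisible[e]; have [_ nunit _] := V_dvr.
elim: e v => [v /(_ v)|e IH v hv]; first by rewrite expr0 mul1r eqxx.
have [vu|/nunit[w vw]] := boolP (v \is a GRing.unit).
  by exists 0%N, v; rewrite mul1r.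
have [|f [u [uu wu]]] := IH w.
  by move=> c; apply: contraNneq (hv c) => wc; rewrite vw wc exprS mulrA.
by exists f.+1, u; split=> //; rewrite vw wu exprS mulrA.
Qed.

Variables (L : fieldType) (iota : {rmorphism V -> L}).
Hypothesis L_frac : is_fraction_field iota.

(** The exponent can be taken large, which [component_surj] needs to make numerator degrees
    nonnegative. *)
Lemma frac_field_dvr (z : L) (k0 : nat) :
  exists c k, (k0 <= k)%N /\ z = iota c / iota t ^+ k.
Proof.
have [iota_inj surj] := L_frac; have [x [v [v0 ->]]] := surj z.
have [e [u [uu ->]]] := dvr_factor v0.
exists (t ^+ k0 * (x * u^-1)), (k0 + e)%N; rewrite leq_addr; split=> //.
have [t0 _ _] := V_dvr.
have it0 : iota t != 0 by rewrite -(rmorph0 iota) (inj_eq iota_inj).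
rewrite !rmorphM !rmorphXn (rmorphV _ uu) exprD -mulf_div divff ?expf_neq0 //.
by rewrite mul1r invfM mulrA mulrAC.
Qed.

End DvrFactorization.

Local Notation frac := Defs.frac.

Section StalkFractions.
Variables (V : idomainType) (t : V) (L K : fieldType).
Variables (iota : {rmorphism V -> L}) (pi : {rmorphism V -> K}).
Hypothesis t_neq0 : t != 0.
Hypothesis iota_inj : injective iota.
Implicit Types (s : stalk_type) (c : V).

(* The image of c / t ^ k; on the stalks V and K the denominator is dropped. *)
Definition stalk_frac s c (k : nat) : stalk iota pi s :=
  match s with
  | StalkL => iota c / iota t ^+ k
  | StalkV => c
  | StalkK => pi c
  end.

Lemma stalk_fracP s a c c' k :
  stalk_frac s (a * c + c') k = a *: stalk_frac s c k + stalk_frac s c' k.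
Proof.
case: s => /=; rewrite ?rmorphD ?rmorphM //.
by rewrite mulrDl -mulrA.
Qed.

Lemma stalk_frac0 s k : stalk_frac s 0 k = 0.
Proof. by case: s => /=; rewrite ?rmorph0 ?mul0r. Qed.

Lemma stalk_fracB s c c' k :
  stalk_frac s (c - c') k = stalk_frac s c k - stalk_frac s c' k.
Proof.
have := stalk_fracP s (-1) c' c k.
by rewrite mulN1r addrC => ->; rewrite scaleN1r addrC.
Qed.

(** The factor that the numerator acquires when the denominator exponent rises by one. *)
Definition stalk_unit s : V := if s is StalkL then t else 1.

Lemma iota_t_neq0 k : iota t ^+ k != 0.
Proof. by rewrite expf_neq0 // -(rmorph0 iota) (inj_eq iota_inj). Qed.

Lemma stalk_frac_cancel s c j k :
  stalk_frac s (stalk_unit s ^+ j * c) (j + k) = stalk_frac s c k.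
Proof.
case: s => /=; rewrite ?expr1n ?mul1r //.
by rewrite rmorphM rmorphXn exprD -mulf_div divff ?iota_t_neq0 // mul1r.
Qed.

End StalkFractions.

(** * Homogeneous fractions and their values in the stalks *)

Section StalkOfFace.
Variables (V : idomainType) (t : V) (L K : fieldType).
Variables (iota : {rmorphism V -> L}) (pi : {rmorphism V -> K}).
Hypothesis V_dvr : is_dvr t.
Hypothesis L_frac : is_fraction_field iota.
Hypothesis K_res : is_residue_field t pi.
Variables (n : nat) (Delta : scomplex n.+1).
Implicit Types (U S : {set 'I_n.+1}) (a b : 'I_n -> int) (p : {mpoly V[n]}).

Let t_neq0 : t != 0. Proof. by case: V_dvr. Qed.
Let iota_inj : injective iota. Proof. by case: L_frac. Qed.
Let pi_ker : forall x : V, pi x = 0 <-> exists y, x = t * y.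
Proof. by case: K_res. Qed.

Local Notation frac_of := (stalk_frac t iota pi).
Local Notation classR := (SR_class t Delta).
Local Notation y := (SR_elt t Delta).

(** The stalk carried by [R_(y_S)] in degree [a], for a face [U = S :|: pos_support a]. *)
Definition sr_type U : stalk_type :=
  if ord0 \in U then StalkL else if ord0 |: U \in Delta then StalkV else StalkK.

Lemma sr_type_unit S b : stalk_unit t (sr_type (S :|: pos_support b)) = tcoef t S.
Proof.
rewrite /sr_type /tcoef in_setU ord0_pos_support orbF.
by case: (ord0 \in S) => //; case: ifP.
Qed.

(** By [SR_coef_mem] the coefficient vanishes if [ord0 |: U] is a face, as it is when [v_0] lies in
    [U]; otherwise it is a multiple of [t], killed by [pi]. This makes [component] well defined. *)
Lemma stalk_frac_zcoef_eq0 U b r k : classR r = 0 -> U \in Delta ->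
  pos_support b \subset U -> frac_of (sr_type U) (zcoef b r) k = 0.
Proof.
move=> r0 UD bU; rewrite /zcoef; case: forallP => [b0|_]; last exact: stalk_frac0.
set m := nat_exponent b.
have mU : mnm_support m \subset U.
  apply: subset_trans bU; apply/subsetP => _ /imsetP[j + ->].
  by rewrite mem_pos_support inE mnmE gez0_abs.
have [r1 r2] := SR_coef_mem m r0; rewrite /sr_type.
case: ifPn => U0; last case: ifPn => U1.
- rewrite r2 ?stalk_frac0 //; apply: faces_sub UD _.
  by rewrite subUset sub1set U0.
- by rewrite r2 // (faces_sub U1) // setUS.
- have [c ->] := r1 (faces_sub UD mU).
  by apply/pi_ker; exists c.
Qed.

(** The degree of the numerator of a degree [a] fraction over [y_S ^ k]. *)
Definition exp_shift a S (k : nat) : 'I_n -> int :=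
  fun j => a j + k%:Z * (lift ord0 j \in S)%:Z.

Lemma exp_shiftD a S i j : exp_shift a S (i + j) = exp_shift (exp_shift a S j) S i.
Proof. by apply/funext => ?; rewrite /exp_shift PoszD mulrDl addrCA addrC -!addrA. Qed.

Lemma zcoef_prod b S k p :
  zcoef (exp_shift b S k) ((\prod_(i in S) SR_var t i) ^+ k * p) =
  tcoef t S ^+ k * zcoef b p.
Proof.
rewrite SR_var_prod exprZn mpolyXn -scalerAl zcoefZ; congr (_ * _).
rewrite -(zcoefXM b (set_mnm S *+ k)); apply: eq_zcoef => j.
by rewrite mulmnE mnmE mulnC PoszM.
Qed.

Lemma zcoef_prodD b S k l p :
  zcoef (exp_shift b S (k + l)) ((\prod_(i in S) SR_var t i) ^+ k * p) =
  tcoef t S ^+ k * zcoef (exp_shift b S l) p.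
Proof. by rewrite exp_shiftD zcoef_prod. Qed.

Lemma SR_elt_prod S : \prod_(i in S) y i = classR (\prod_(i in S) SR_var t i).
Proof. by rewrite rmorph_prod. Qed.

Lemma SR_class_surj (r : SR_ring t Delta) : exists p, r = classR p.
Proof. exact: ring_class_surj. Qed.

Lemma loc_surj S (x : loc (\prod_(i in S) y i)) : exists p k, x = frac _ (classR p) k.
Proof.
have [r [k ->]] := frac_surj x; have [p ->] := SR_class_surj r.
by exists p, k.
Qed.

(* Independent of the chosen representative of x only when S :|: pos_support a is
   a face of type s; see componentE. *)
Definition component a S s (x : loc (\prod_(i in S) y i)) : stalk iota pi s :=
  frac_of s (zcoef (exp_shift a S (loc_exp x)) (quotring_rep (loc_num x))) (loc_exp x).

(** Two representatives [p / y_S ^ k] and [q / y_S ^ l] agree in [R] after multiplication by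
    [y_S ^ (m + l)] and [y_S ^ (m + k)]; the coefficients in degree [a + (m + l + k) deg y_S] are
    compared. *)
Lemma componentE a S p k : S :|: pos_support a \in Delta ->
  component a (sr_type (S :|: pos_support a)) (frac (\prod_(i in S) y i) (classR p) k) =
  frac_of (sr_type (S :|: pos_support a)) (zcoef (exp_shift a S k) p) k.
Proof.
move=> UD; rewrite /component; set x := frac _ _ _; set U := S :|: _ in UD *.
move: (loc_repr x) => /frac_eq[m].
have := esym (quotring_repK (loc_num x)).
move: (loc_exp x) (loc_num x) (quotring_rep (loc_num x)) => l _ q -> e.
have {}e : classR ((\prod_(i in S) SR_var t i) ^+ (m + l) * p -
                   (\prod_(i in S) SR_var t i) ^+ (m + k) * q) = 0.
  apply/eqP; rewrite rmorphB !rmorphM !rmorphXn subr_eq0; apply/eqP.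
  by rewrite -SR_elt_prod.
have := @stalk_frac_zcoef_eq0 U (exp_shift a S (m + l + k)) _ (m + l + k) e UD.
have -> : pos_support (exp_shift a S (m + l + k)) \subset U.
  apply/subsetP => _ /imsetP[j + ->]; rewrite inE in_setU mem_pos_support.
  by rewrite /exp_shift; case: (lift _ _ \in S) => //=; lia.
move=> /(_ isT); rewrite zcoefB stalk_fracB zcoef_prodD.
rewrite [in X in _ - X]addnAC zcoef_prodD -(sr_type_unit S a) -/U.
by rewrite !stalk_frac_cancel // => /eqP; rewrite subr_eq0 => /eqP.
Qed.

Lemma componentP a S c (x x' : loc (\prod_(i in S) y i)) :
  let s := sr_type (S :|: pos_support a) in
  S :|: pos_support a \in Delta ->
  component a s (SR_alg t Delta c *: x + x') =
  c *: component a s x + component a s x'.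
Proof.
move=> s UD; have [p [k ->]] := loc_surj x; have [q [l ->]] := loc_surj x'.
have -> : SR_alg t Delta c *: frac (\prod_(i in S) y i) (classR p) k
      + frac (\prod_(i in S) y i) (classR q) l =
    frac (\prod_(i in S) y i) (classR ((\prod_(i in S) SR_var t i) ^+ l * (c%:MP * p)
      + (\prod_(i in S) SR_var t i) ^+ k * q)) (k + l).
  rewrite fracZ fracD; congr (frac _ _ _).
  by rewrite rmorphD !rmorphM !rmorphXn -SR_elt_prod.
rewrite !componentE // -/s.
rewrite zcoefD [in X in X + _]addnC !zcoef_prodD.
rewrite mul_mpolyC zcoefZ mulrCA stalk_fracP.
rewrite -!(sr_type_unit S a) -/s stalk_frac_cancel //.
by rewrite addnC stalk_frac_cancel.
Qed.

(** If [v_0] is new in [S'], the factor [t ^+ k] cancels the denominator, and the source has type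
    [V] because [S'] yields a face. In the other cases the factor is one, and the types agree or
    pass from [V] to [K]. *)
Lemma stalk_frac_res a S S' c k : S \subset S' -> S' :|: pos_support a \in Delta ->
  let s := sr_type (S :|: pos_support a) in
  let s' := sr_type (S' :|: pos_support a) in
  frac_of s' (tcoef t (S' :\: S) ^+ k * c) k =
  stalk_res iota pi s s' (frac_of s c k).
Proof.
move=> SS' UD' s s'; rewrite /s /s' /sr_type /tcoef !in_setU !ord0_pos_support !orbF.
rewrite inE; have /implyP := subsetP SS' ord0.
have UU' : S :|: pos_support a \subset S' :|: pos_support a by rewrite setSU.
have [_|_] := boolP (ord0 \in S) => /=.
  by move=> /= ->; rewrite expr1n mul1r.
have [S'0 _|_ _] := boolP (ord0 \in S').
  rewrite ifT /=.
    by rewrite rmorphM rmorphXn mulrAC divff ?mul1r ?iota_t_neq0.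
  apply: faces_sub UD' _; rewrite subUset UU' andbT sub1set in_setU S'0 //.
rewrite expr1n mul1r; case: ifPn => D'; case: ifPn => D //=.
by case/negP: D; apply: faces_sub D' _; rewrite setUS.
Qed.

Lemma exp_shift_setD a S S' k : S \subset S' ->
  exp_shift a S' k = exp_shift (exp_shift a S k) (S' :\: S) k.
Proof.
move=> SS'; apply/funext => j; rewrite /exp_shift -addrA -mulrDr inE.
congr (_ + _ * _); have := subsetP SS' (lift ord0 j).
by case: (_ \in S) => [->|_] //=; rewrite add0r.
Qed.

Section CechRestriction.
Variables (F G : face (full_simplex n.+1)) (h : val F \subset val G).
Variable a : 'I_n -> int.
Hypothesis UD : val G :|: pos_support a \in Delta.

Lemma cech_resE p k :
  cech_res y h (frac (\prod_(i in val F) y i) (classR p) k) =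
  frac (\prod_(i in val G) y i)
    (classR ((\prod_(i in val G :\: val F) SR_var t i) ^+ k * p)) k.
Proof. by rewrite [LHS]loc_mapE rmorphM rmorphXn -SR_elt_prod. Qed.

Lemma component_res (x : cech_sections y F) :
  component a (sr_type (val G :|: pos_support a)) (cech_res y h x) =
  stalk_res iota pi (sr_type (val F :|: pos_support a))
    (sr_type (val G :|: pos_support a))
    (component a (sr_type (val F :|: pos_support a)) x).
Proof.
have [p [k ->]] := loc_surj x; rewrite cech_resE !componentE //; last first.
  by apply: faces_sub UD _; rewrite setSU.
by rewrite (exp_shift_setD _ _ h) zcoef_prod -stalk_frac_res.
Qed.

(** Without [x_j] in the denominator, a fraction has no part of negative degree in [x_j]. *)
Lemma component_res_eq0 (x : cech_sections y F) j :
  a j < 0 -> lift ord0 j \notin val F ->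
  component a (sr_type (val G :|: pos_support a)) (cech_res y h x) = 0.
Proof.
move=> aj jF; have [p [k ->]] := loc_surj x; rewrite cech_resE componentE //.
rewrite (exp_shift_setD _ _ h) zcoef_prod (@zcoef_neg _ _ _ _ j).
  by rewrite mulr0 stalk_frac0.
by rewrite /exp_shift (negPf jF) mulr0 addr0.
Qed.

End CechRestriction.

Lemma loc_homog_res b (F G : face (full_simplex n.+1)) (h : val F \subset val G)
    (x : cech_sections y F) :
  @loc_homog _ t _ Delta (val F) b x -> @loc_homog _ t _ Delta (val G) b (cech_res y h x).
Proof.
move=> [r [k [-> hr]]]; rewrite [cech_res _ _ _]loc_mapE.
exists ((\prod_(i in val G :\: val F) y i) ^+ k * r), k; split=> //.
apply: SR_homog_eq (SR_homog_exp (val G :\: val F) k hr) => j.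
by have := congr1 (fun f => f j) (exp_shift_setD b k h).
Qed.

Lemma loc_homog_zterm S b (x : loc (\prod_(i in S) y i)) : loc_homog b x ->
  exists p k, x = frac _ (classR (zterm (exp_shift b S k) p)) k.
Proof.
by move=> [_ [k [-> [p -> hp]]]]; exists p, k; rewrite -(zterm_homog hp).
Qed.

Lemma zterm_loc_homog S b p k :
  loc_homog b (frac (\prod_(i in S) y i) (classR (zterm (exp_shift b S k) p)) k).
Proof.
exists (classR (zterm (exp_shift b S k) p)), k; split=> //.
by exists (zterm (exp_shift b S k) p) => //; apply: zterm_supp.
Qed.

Lemma frac_eq0 S p k l : classR ((\prod_(i in S) SR_var t i) ^+ l * p) = 0 ->
  frac (\prod_(i in S) y i) (classR p) k = 0.
Proof.
move=> e; apply/frac_eq; exists l.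
by rewrite addn0 mulr0 -e rmorphM rmorphXn -SR_elt_prod.
Qed.

Lemma pos_support_shift a S k :
  pos_support a \subset S :|: mnm_support (nat_exponent (exp_shift a S k)).
Proof.
apply/subsetP => _ /imsetP[j + ->]; rewrite !inE mem_pos_support mnmE /exp_shift.
by case: (_ \in S) => //=; rewrite mulr0 addr0; lia.
Qed.

(** Multiplying the numerator once by [y_S] gives a monomial whose support, joined with [S],
    contains the nonface [S :|: pos_support a]. *)
Lemma loc_homog_nonface S a (x : loc (\prod_(i in S) y i)) :
  S :|: pos_support a \notin Delta -> loc_homog a x -> x = 0.
Proof.
move=> UD /loc_homog_zterm[p [k ->]]; apply: (@frac_eq0 _ _ _ 1).
rewrite expr1 /zterm -scalerAr -mul_mpolyC rmorphM SR_monomial_nonface ?mulr0 //.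
apply: contra UD => UD; apply: faces_sub UD _.
by rewrite subUset subsetUl pos_support_shift.
Qed.

Lemma loc_homog_neg S a j (x : loc (\prod_(i in S) y i)) :
  a j < 0 -> lift ord0 j \notin S -> loc_homog a x -> x = 0.
Proof.
move=> aj jS /loc_homog_zterm[p [k ->]]; apply: (@frac_eq0 _ _ _ 0).
rewrite mul1r /zterm (@zcoef_neg _ _ _ _ j) ?scale0r ?rmorph0 //.
by rewrite /exp_shift (negPf jS) mulr0 addr0.
Qed.

(** The numerator is [c x^m]. In types [L] and [V] a zero component forces [c = 0]; in type [K] it
    gives [c = t * c'], and multiplication by [y_S] then produces the monomial of [ord0 |: S] times
    [x^m], which is zero in [R]. *)
Lemma component_inj S a (x : loc (\prod_(i in S) y i)) :
  let s := sr_type (S :|: pos_support a) in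
  S :|: pos_support a \in Delta -> loc_homog a x -> component a s x = 0 -> x = 0.
Proof.
move=> s UD /loc_homog_zterm[p [k ->]]; rewrite componentE // zcoef_zterm ifT; last first.
  exact/forallP.
set c := zcoef _ _; rewrite -/s => c0.
have [p0|pK] := eqVneq c 0.
  by apply: (@frac_eq0 _ _ _ 0); rewrite /zterm -/c p0 scale0r mulr0 rmorph0.
have [c' cc' [SD S0]] : exists2 c', c = t * c' &
    ord0 |: (S :|: pos_support a) \notin Delta /\ ord0 \notin S.
  move: c0; rewrite /s /sr_type in_setU ord0_pos_support orbF.
  case: ifPn => S0; last case: ifPn => SD /=.
  - move=> /eqP; rewrite mulf_eq0 invr_eq0 (negPf (iota_t_neq0 t_neq0 iota_inj _)).
    by rewrite orbF -(rmorph0 iota) (inj_eq iota_inj) (negPf pK).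
  - by move=> /eqP; rewrite (negPf pK).
  - by move=> /pi_ker[c' cc']; exists c'.
apply: (@frac_eq0 _ _ _ 1); rewrite expr1 /zterm -/c cc'.
set m := nat_exponent _.
have -> : (\prod_(i in S) SR_var t i) * ((t * c') *: 'X_[m]) =
    c'%:MP * ((\prod_(i in ord0 |: S) SR_var t i) * 'X_[m]).
  rewrite big_setU1 //= -mul_mpolyC mpolyCM /SR_var unlift_none.
  by rewrite -!mulrA [LHS]mulrCA [RHS]mulrCA; congr (_ * _); apply: mulrCA.
rewrite rmorphM SR_monomial_nonface ?mulr0 //.
apply: contra SD => SD; apply: faces_sub SD _.
by rewrite -setUA setUS // subUset subsetUl pos_support_shift.
Qed.

Lemma component_neq S a b (x : loc (\prod_(i in S) y i)) j :
  let s := sr_type (S :|: pos_support a) in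
  S :|: pos_support a \in Delta -> loc_homog b x -> b j != a j ->
  component a s x = 0.
Proof.
move=> s UD /loc_homog_zterm[p [k ->]] abj; rewrite componentE // zcoef_zterm.
rewrite ifF ?stalk_frac0 //; apply/forallP => /(_ j).
by rewrite /exp_shift (inj_eq (addIr _)) (negPf abj).
Qed.

Lemma stalk_frac_surj s (u : stalk iota pi s) k0 :
  exists c k, (k0 <= k)%N /\ u = frac_of s c k.
Proof.
case: s u => /= u.
- exact: frac_field_dvr.
- by exists u, k0.
- by have [/(_ u)[c uc] _] := K_res; exists c, k0.
Qed.

Lemma component_surj S a (u : stalk iota pi (sr_type (S :|: pos_support a))) :
  S :|: pos_support a \in Delta -> neg_support a \subset S ->
  exists x : loc (\prod_(i in S) y i),
    loc_homog a x /\ component a (sr_type (S :|: pos_support a)) x = u.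
Proof.
(* An exponent [k] of at least the sum of the absolute values of [a] makes the numerator degree
   nonnegative, since negative entries occur only at vertices of [S]. *)
move=> UD GS; have [c [k [ak ->]]] := stalk_frac_surj u (\sum_j `|a j|)%N.
have b0 j : 0 <= exp_shift a S k j.
  have aj : (`|a j| <= k)%N by apply: leq_trans ak; rewrite (bigD1 j) //= leq_addr.
  rewrite /exp_shift; have := subsetP GS (lift ord0 j); rewrite mem_neg_support.
  by case: (_ \in S) => /= [_|/implyP]; lia.
set b := exp_shift a S k in b0.
have cE : zcoef b (c *: 'X_[nat_exponent b]) = c.
  by rewrite zcoefZ /zcoef ifT ?mcoeffX ?eqxx ?mulr1 //; apply/forallP.
exists (frac _ (classR (zterm b (c *: 'X_[nat_exponent b]))) k); split.
  exact: zterm_loc_homog.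
by rewrite componentE // zcoef_zterm ifT ?cE //; apply/forallP.
Qed.

(** Taken on the chosen representative of [x]; what matters is that the parts are homogeneous and
    that finitely many of them sum to [x]. *)
Definition homog_part S b (x : loc (\prod_(i in S) y i)) : loc (\prod_(i in S) y i) :=
  frac _ (classR (zterm (exp_shift b S (loc_exp x)) (quotring_rep (loc_num x))))
    (loc_exp x).

Lemma homog_partP S b (x : loc (\prod_(i in S) y i)) : loc_homog b (homog_part b x).
Proof. exact: zterm_loc_homog. Qed.

(** Degrees outside [A] contribute zero, so any larger list works; this lets one list serve all
    entries of a cochain. Finite functions give the degrees a decidable equality. *)
Lemma mpoly_sum_zterm S k p : exists A : seq {ffun 'I_n -> int},
  forall A', uniq A' -> {subset A <= A'} ->
    p = \sum_(b <- A') zterm (exp_shift b S k) p.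
Proof.
pose sh (m : 'X_{1..n}) : {ffun 'I_n -> int} :=
  [ffun j => (m j)%:Z - k%:Z * (lift ord0 j \in S)%:Z].
exists [seq sh m | m <- msupp p] => A' uA' AA'; apply/mpolyP => m.
have coefE (b : {ffun 'I_n -> int}) :
    (zterm (exp_shift b S k) p)@_m = if b == sh m then p@_m else 0.
  rewrite mcoeff_zterm; congr (if _ then _ else _); apply/forallP/eqP => [bm|-> j].
    by apply/ffunP => j; rewrite ffunE -(eqP (bm j)) /exp_shift addrK.
  by rewrite /exp_shift ffunE subrK.
rewrite raddf_sum /=; have [mA'|mA'] := boolP (sh m \in A').
  rewrite (bigD1_seq (sh m)) //= coefE eqxx big1 ?addr0 // => b /negPf bm.
  by rewrite coefE bm.
rewrite memN_msupp_eq0; last by apply: contra mA' => mp; apply/AA'/map_f.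
rewrite big_seq big1 // => b bA'; rewrite coefE; case: eqP => // bm.
by rewrite -bm bA' in mA'.
Qed.

Lemma frac_sum S (I : Type) (r : seq I) (F : I -> {mpoly V[n]}) k :
  frac (\prod_(i in S) y i) (classR (\sum_(i <- r) F i)) k =
  \sum_(i <- r) frac (\prod_(i in S) y i) (classR (F i)) k.
Proof.
apply: (big_morph (fun p => frac (\prod_(i in S) y i) (classR p) k)); last first.
  by apply: (@frac_eq0 _ _ _ 0); rewrite mulr0 rmorph0.
by move=> p q; rewrite fracD -mulrDr frac_cancel rmorphD.
Qed.

Lemma homog_part_sum S (x : loc (\prod_(i in S) y i)) :
  exists A : seq {ffun 'I_n -> int},
  forall A', uniq A' -> {subset A <= A'} -> x = \sum_(b <- A') homog_part b x.
Proof.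
have [A Ap] := mpoly_sum_zterm S (loc_exp x) (quotring_rep (loc_num x)).
exists A => A' uA' AA'.
rewrite {1}(loc_repr x) -{1}(quotring_repK (loc_num x)) {1}(Ap A' uA' AA').
exact: frac_sum.
Qed.

End StalkOfFace.

(** * Homogeneous components of local cohomology *)

Section CechCochains.
Variables (V : idomainType) (t : V) (n : nat) (Delta : scomplex n.+1).
Implicit Types (S : {set 'I_n.+1}) (b : 'I_n -> int).
Local Notation y := (SR_elt t Delta).

Lemma loc_homog0 b S : @loc_homog _ t _ Delta S b 0.
Proof. by exists 0, 0%N; split=> //; apply: SR_homog0. Qed.

Lemma loc_homogB b S (x x' : loc (\prod_(i in S) y i)) :
  loc_homog b x -> loc_homog b x' -> loc_homog b (x - x').
Proof.
move=> hx hx'; have := loc_homogP (-1) hx' hx.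
by rewrite rmorphN1 scaleN1r addrC.
Qed.

Local Notation cech := (cech_sheaf y).

Definition cochain_homog i b (z : cochains cech i) : Prop :=
  cochain_in (fun (F : face (full_simplex n.+1)) (x : sections cech F) =>
    @loc_homog _ t _ Delta (val F) b x) z.

Lemma coboundary_homog i j b (z : cochains cech i) : j = i + 1 ->
  cochain_homog b z -> cochain_homog b (coboundary cech i j z).
Proof.
apply: cochain_in_coboundary => [F|F x x'|F G h x].
- exact: loc_homog0.
- exact: loc_homogB.
- exact: loc_homog_res.
Qed.

Lemma local_cohomology_degE i b (u : local_cohomology t Delta i) :
  u \in local_cohomology_deg t Delta i b <->
  exists2 z, u = quot_class (boundaries _ _) z & cochain_homog b (val z).
Proof.
by split=> [|uz]; rewrite inE; [move/asboolP|apply/asboolP].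
Qed.

End CechCochains.

Section CechComponents.
Variables (V : idomainType) (t : V) (L K : fieldType).
Variables (iota : {rmorphism V -> L}) (pi : {rmorphism V -> K}).
Hypothesis V_dvr : is_dvr t.
Hypothesis L_frac : is_fraction_field iota.
Hypothesis K_res : is_residue_field t pi.
Variables (n : nat) (Delta : scomplex n.+1).
Implicit Types (S : {set 'I_n.+1}) (a b : 'I_n -> int).

Local Notation y := (SR_elt t Delta).
Local Notation cech := (cech_sheaf y).
Local Notation component := (component iota pi).
Local Notation sr_type := (sr_type Delta).

Lemma component0 a S : S :|: pos_support a \in Delta ->
  component a (sr_type (S :|: pos_support a)) (0 : loc (\prod_(i in S) y i)) = 0.
Proof.
move=> UD; have := componentP V_dvr L_frac K_res 1 0 0 UD.
by rewrite scaler0 addr0 scale1r -[LHS]addr0 => /addrI/esym.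
Qed.

Lemma component_sum a S (I : Type) (r : seq I) (P : pred I)
    (x : I -> loc (\prod_(i in S) y i)) :
  S :|: pos_support a \in Delta ->
  component a (sr_type (S :|: pos_support a)) (\sum_(v <- r | P v) x v) =
  \sum_(v <- r | P v) component a (sr_type (S :|: pos_support a)) (x v).
Proof.
move=> UD; apply: big_morph; last exact: component0.
move=> u v; have := componentP V_dvr L_frac K_res 1 u v UD.
by rewrite rmorph1 !scale1r.
Qed.

Lemma stalk_res_eq0 s s' u : s = s' -> stalk_res iota pi s s' u = 0 -> u = 0.
Proof. by move=> <-; rewrite stalk_res_id. Qed.

Section PositiveVertex.
Variables (a : 'I_n -> int) (k : 'I_n).
Hypothesis ak : 0 < a k.
Local Notation v := (lift ord0 k).
Variables (F G : face (full_simplex n.+1)) (h : val F \subset val G).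
Hypothesis GF : val G = v |: val F.

(** Hence [F] and [v |: F] have the same [sr_type], and restriction between them is the identity on
    stalks. *)
Lemma pos_vertex_support : val G :|: pos_support a = val F :|: pos_support a.
Proof.
rewrite GF -setUA; apply/setUidPr.
by rewrite sub1set in_setU mem_pos_support ak orbT.
Qed.

Lemma pos_vertex_res_inj x : loc_homog a x -> cech_res y h x = 0 -> x = 0.
Proof.
move=> hx x0; have [UD|UD] := boolP (val F :|: pos_support a \in Delta); last first.
  exact: loc_homog_nonface UD hx.
apply: (component_inj V_dvr L_frac K_res UD hx).
have UD' : val G :|: pos_support a \in Delta by rewrite pos_vertex_support.
have := component_res V_dvr L_frac K_res h UD' x; rewrite x0 component0 //.
by move/esym; apply: stalk_res_eq0; rewrite pos_vertex_support.
Qed.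

(** If [val F :|: pos_support a] is not a face, or [F] misses a vertex of negative degree, the same
    holds for [G] and [x'] is zero. Otherwise [x] is found with the component of [x']. *)
Lemma pos_vertex_res_surj x' : @loc_homog _ t _ Delta (val G) a x' ->
  exists x, @loc_homog _ t _ Delta (val F) a x /\ cech_res y h x = x'.
Proof.
move=> hx'; have [UD|UD] := boolP (val F :|: pos_support a \in Delta); last first.
  exists 0; split; first exact: loc_homog0.
  rewrite linear0; apply/esym/(loc_homog_nonface V_dvr _ hx').
  by rewrite pos_vertex_support.
have [GS|/subsetPn[_ /imsetP[j + ->] jF]] :=
  boolP (neg_support a \subset val F); last first.
  rewrite inE => aj; exists 0; split; first exact: loc_homog0.
  rewrite linear0; apply/esym/(loc_homog_neg aj _ hx').
  rewrite GF in_setU1 negb_or jF andbT (inj_eq lift_inj).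
  by apply: contraTneq aj => ->; rewrite -leNgt ltW.
have UD' : val G :|: pos_support a \in Delta by rewrite pos_vertex_support.
have [x [hx cx]] := component_surj V_dvr L_frac K_res
  (stalk_res iota pi _ _ (component a (sr_type (val G :|: pos_support a)) x')) UD GS.
exists x; split=> //; apply/eqP; rewrite -subr_eq0; apply/eqP.
have hd := loc_homogB (loc_homog_res h hx) hx'.
apply: (component_inj V_dvr L_frac K_res UD' hd).
have := componentP V_dvr L_frac K_res (-1) x' (cech_res y h x) UD'.
rewrite rmorphN1 !scaleN1r addrC => ->.
rewrite (component_res V_dvr L_frac K_res h UD' x) cx.
move: (component _ _ x'); rewrite pos_vertex_support => u.
by rewrite !stalk_res_id addNr.
Qed.

End PositiveVertex.

End CechComponents.

(** * Local cohomology in a fixed degree *)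

Section DegreeComponents.
Variables (V : idomainType) (t : V) (L K : fieldType).
Variables (iota : {rmorphism V -> L}) (pi : {rmorphism V -> K}).
Hypothesis V_dvr : is_dvr t.
Hypothesis L_frac : is_fraction_field iota.
Hypothesis K_res : is_residue_field t pi.
Variables (n : nat) (Delta : scomplex n.+1).
Local Notation y := (SR_elt t Delta).
Local Notation cech := (cech_sheaf y).
Local Notation FS := (full_simplex n.+1).
Local Notation in_degree :=
  (fun (a : 'I_n -> int) (F : face FS) x => @loc_homog V t n Delta (val F) a x).

(** The vertex of [x_k] is a cone vertex for the degree [a] part of the Cech complex. *)
Lemma positive_degree_eq0 i a k : 0 < a k ->
  is_zero_module (submod_type (local_cohomology_deg t Delta i a)).
Proof.
move=> ak; apply/(homogeneous_homology_eq0 (local_cohomology_degE a)) => z dz hz.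
have inj (F F' : face FS) (h : val F \subset val F') x
    (FF' : val F' = lift ord0 k |: val F) :=
  @pos_vertex_res_inj _ _ _ _ _ _ V_dvr L_frac K_res _ Delta _ _ ak F F' h FF' x.
have surj (F F' : face FS) (h : val F \subset val F') x'
    (FF' : val F' = lift ord0 k |: val F) :=
  @pos_vertex_res_surj _ _ _ _ _ _ V_dvr L_frac K_res _ Delta _ _ ak F F' h FF' x'.
exact: (@cone_coboundary _ _ cech (in_degree a) (fun F => loc_homog0 t Delta a (val F))
  (fun F => @loc_homogB _ t _ Delta a (val F))
  (fun F F' h x => @loc_homog_res _ t _ Delta a F F' h x) _ inj surj _ _ dz hz).
Qed.

Section NonpositiveDegree.
Variable a : 'I_n -> int.
Hypothesis a_le0 : forall k, a k <= 0.
Local Notation G := (neg_support a).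
Local Notation Lambda := (link Delta G).

Lemma pos_support_eq0 : pos_support a = set0.
Proof.
apply/setP => i; rewrite inE; apply/imsetP => -[j + _].
by rewrite inE ltNge a_le0.
Qed.

Lemma nonpositive_homog_eq0 (S : {set 'I_n.+1}) (x : loc (\prod_(i in S) y i)) :
  ~~ ((G \subset S) && (S \in Delta)) -> loc_homog a x -> x = 0.
Proof.
rewrite negb_and => /orP[/subsetPn[_ /imsetP[j + ->] jS]|SD].
  by rewrite inE => aj; apply: loc_homog_neg aj jS.
by apply: (loc_homog_nonface V_dvr); rewrite pos_support_eq0 setU0.
Qed.

(** A face containing [G] would make [G] a face, so every cochain of degree [a] is zero. *)
Lemma nonface_degree_eq0 i : G \notin Delta ->
  is_zero_module (submod_type (local_cohomology_deg t Delta i a)).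
Proof.
move=> GD; apply/(homogeneous_homology_eq0 (local_cohomology_degE a)) => z dz hz.
exists 0; rewrite linear0; apply/ffunP => T; rewrite ffunE.
apply: nonpositive_homog_eq0 (hz T); apply: contra GD => /andP[GT TD].
exact: faces_sub TD GT.
Qed.

Lemma link_face (F : {set 'I_n.+1}) : F \in Lambda ->
  [/\ F \in Delta, [disjoint G & F] & G :|: F \in Delta].
Proof. by rewrite !inE -setI_eq0 => /and3P[]. Qed.

(** Since [v_0] is not in [G], joining [v_0] to [F] inside the link amounts to joining it to
    [G :|: F] in [Delta]. *)
Lemma link_face_type (F : {set 'I_n.+1}) : F \in Lambda ->
  face_type Lambda F = sr_type Delta (G :|: F :|: pos_support a).
Proof.
move=> FL; have [FD GF GFD] := link_face FL.
rewrite pos_support_eq0 setU0 /face_type /sr_type in_setU ord0_neg_support /=.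
case: ifPn => // F0.
suff -> : (F \in link Lambda [set ord0]) = (ord0 |: (G :|: F) \in Delta) by [].
have e : G :|: (ord0 |: F) = ord0 |: (G :|: F) by rewrite setUCA.
have d0 : [set ord0] :&: F == set0 by rewrite setI_eq0 disjoints1.
rewrite inE FL d0 /= inE e setIUr (disjoint_setI0 GF) setU0.
have -> : G :&: [set ord0] == set0.
  by rewrite setI_eq0 disjoint_sym disjoints1 ord0_neg_support.
rewrite /=; apply/andb_idl => D0; apply: faces_sub D0 _.
by rewrite setUS // subsetUr.
Qed.

(** Written with [face_type] so that the value lies in the stalk of [dvr_sheaf]; [link_face_type]
    translates to [sr_type]. *)
Definition link_component (F : face Lambda) (x : sections cech (full_face (G :|: val F))) :
    sections (dvr_sheaf iota pi Lambda) F :=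
  component iota pi a (face_type Lambda (val F)) x.

Lemma nonpositive_degree_iso i : G \in Delta ->
  isomorphic (submod_type (local_cohomology_deg t Delta i a))
    (cohomology (dvr_sheaf iota pi Lambda) (i - #|G|%:Z - 1)).
Proof.
move=> GD; have UD (F : face Lambda) : G :|: val F :|: pos_support a \in Delta.
  by have [_ _] := link_face (valP F); rewrite pos_support_eq0 setU0.
(* The Cech complex in degree [i] is the cochain complex in degree [i - 1], and passage to the link
   subtracts [#|G|]. *)
have -> : i - #|G|%:Z - 1 = i - 1 - #|G|%:Z by rewrite addrAC.
apply: (@link_cohomology_iso _ _ _ _ _ _ _ cech _ (in_degree a) _ _ _ link_component).
- by move=> F /link_face[].
- by move=> F; apply: loc_homog0.
- by move=> F x x'; apply: loc_homogB.
- by move=> F F' h x; apply: loc_homog_res.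
- move=> F c x x'; rewrite /link_component.
  have := componentP V_dvr L_frac K_res c x x' (UD F).
  rewrite -(link_face_type (valP F)).
  exact.
- move=> F F' h h' x; rewrite /link_component.
  have := component_res V_dvr L_frac K_res h' (UD F') x.
  rewrite -(link_face_type (valP F)) -(link_face_type (valP F')).
  exact.
- move=> E F h x /subsetPn[_ /imsetP[j + ->] jE]; rewrite inE => aj.
  have := component_res_eq0 V_dvr L_frac K_res h (UD F) x aj jE.
  by rewrite -(link_face_type (valP F)).
- move=> F x hx; have := component_inj V_dvr L_frac K_res (UD F) hx.
  by rewrite /= -(link_face_type (valP F)).
- move=> F; have := fun u => component_surj V_dvr L_frac K_res u (UD F) (subsetUl _ _).
  by rewrite -(link_face_type (valP F)).
(* If [E] is a face containing [G], then [E :\: G] lies in the link, so [E] is of the form excluded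
   by [EF]. *)
- move=> E x EF hx; apply: nonpositive_homog_eq0 hx; apply/negP => /andP[GE ED].
  have FL : val E :\: G \in Lambda.
    have ED' : val E :\: G \in Delta := faces_sub ED (subsetDl _ _).
    have GED : G :|: (val E :\: G) \in Delta.
      by apply: faces_sub ED _; rewrite subUset GE subsetDl.
    rewrite inE ED' GED andbT setI_eq0 disjoint_sym disjoints_subset setDE.
    exact: subsetIr.
  apply: (EF (exist _ (val E :\: G) FL)); apply/setP => v.
  by rewrite !inE; have := subsetP GE v; case: (v \in G) => // ->.
- exact: local_cohomology_degE.
Qed.

End NonpositiveDegree.

End DegreeComponents.

(** * Decomposition of cocycles into homogeneous ones *)

Section HomogeneousDecomposition.
Variables (V : idomainType) (t : V) (L K : fieldType).
Variables (iota : {rmorphism V -> L}) (pi : {rmorphism V -> K}).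
Hypothesis V_dvr : is_dvr t.
Hypothesis L_frac : is_fraction_field iota.
Hypothesis K_res : is_residue_field t pi.
Variables (n : nat) (Delta : scomplex n.+1).
Local Notation y := (SR_elt t Delta).
Local Notation cech := (cech_sheaf y).

(** The component in degree [b] kills every other summand and is injective on the summand of degree
    [b]. *)
Lemma homog_independent (S : {set 'I_n.+1}) (A : seq {ffun 'I_n -> int})
    (x : {ffun 'I_n -> int} -> loc (\prod_(i in S) y i)) :
  uniq A -> (forall b : {ffun 'I_n -> int}, loc_homog b (x b)) -> \sum_(b <- A) x b = 0 ->
  forall b, b \in A -> x b = 0.
Proof.
move=> uA hx x0 b bA.
have [UD|UD] := boolP (S :|: pos_support b \in Delta); last first.
  exact: loc_homog_nonface UD (hx b).
apply: (component_inj V_dvr L_frac K_res UD (hx b)).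
have := component_sum V_dvr L_frac K_res A predT x UD.
rewrite x0 component0 // (bigD1_seq b) //= big1 ?addr0 // => b' b'b.
have /existsP[j bj] : [exists j, b' j != b j].
  by apply: contraR b'b => /existsPn b'b; apply/eqP/ffunP => j; apply/eqP/negPn/b'b.
exact: (component_neq V_dvr L_frac K_res UD (hx b') bj).
Qed.

Definition cochain_part i (z : cochains cech i) (b : 'I_n -> int) : cochains cech i :=
  [ffun T : cell (full_simplex n.+1) i => homog_part b (z T) : sections cech (val T)].

Lemma cochain_partP i (z : cochains cech i) b : cochain_homog b (cochain_part z b).
Proof. by move=> T; rewrite ffunE; apply: homog_partP. Qed.

Lemma cochain_part_sum i (z : cochains cech i) : exists2 A : seq {ffun 'I_n -> int},
  uniq A & z = \sum_(b <- A) cochain_part z b.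
Proof.
have [A hA] := fin_all_exists (fun T : cell (full_simplex n.+1) i => homog_part_sum (z T)).
(* The union of the degree lists of all entries. *)
exists (undup (flatten [seq A T | T : cell (full_simplex n.+1) i])).
  exact: undup_uniq.
set s := undup _; apply/ffunP => T.
have As : {subset A T <= s}.
  move=> b bT; rewrite mem_undup; apply/flatten_mapP; exists T => //.
  exact: mem_enum.
rewrite {1}(hA T s (undup_uniq _) As); elim: (s) => [|b s' IH].
  by rewrite !big_nil ffunE.
by rewrite !big_cons !ffunE IH.
Qed.

(** The coboundaries of the parts are homogeneous of distinct degrees and sum to zero. *)
Lemma coboundary_part i j (z : cochains cech i) (A : seq {ffun 'I_n -> int}) :
  j = i + 1 -> uniq A -> z = \sum_(b <- A) cochain_part z b ->
  coboundary cech i j z = 0 ->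
  forall b, b \in A -> coboundary cech i j (cochain_part z b) = 0.
Proof.
move=> ij uA zA dz b bA; apply/ffunP => T; rewrite [RHS]ffunE.
pose x (b : {ffun 'I_n -> int}) := coboundary cech i j (cochain_part z b) T.
apply: (@homog_independent _ A x) => //.
  by move=> b'; apply: coboundary_homog ij (cochain_partP z b') T.
have := congr1 (fun c : cochains cech j => c T) dz.
rewrite [RHS]ffunE {1}zA linear_sum => e; apply: etrans e; rewrite /x.
elim: A {uA zA bA x} => [|b' A IH]; first by rewrite !big_nil ffunE.
by rewrite !big_cons [RHS]ffunE IH.
Qed.

Lemma local_cohomology_eq0 i :
  (forall a, is_zero_module (submod_type (local_cohomology_deg t Delta i a))) ->
  is_zero_module (local_cohomology t Delta i).
Proof.
move=> H0 u; have [z [dz ->]] := homology_surj u; apply/cohomology_class_eq0.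
have [A uA zA] := cochain_part_sum z.
rewrite zA big_seq; apply: (big_ind (fun z => exists w, z = coboundary cech _ _ w)).
- by exists 0; rewrite linear0.
- by move=> _ _ [w ->] [w' ->]; exists (w + w'); rewrite linearD.
move=> b bA; have /(homogeneous_homology_eq0 (local_cohomology_degE b)) Hb := H0 b.
by apply: Hb; [apply: coboundary_part zA dz _ bA | apply: cochain_partP].
Qed.

End HomogeneousDecomposition.

Lemma isomorphic_eq0 (A : pzRingType) (M N : lmodType A) :
  isomorphic M N -> is_zero_module M <-> is_zero_module N.
Proof.
move=> [f [g fg gf]]; split=> [M0 x|N0 x].
  by rewrite -[x]gf (M0 (g x)) linear0.
by apply: (can_inj fg); rewrite linear0; apply: N0.
Qed.

Theorem theorem4p21 (V : idomainType) (t : V) (V_dvr : is_dvr t)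
    (L : fieldType) (iota : {rmorphism V -> L}) (L_frac : is_fraction_field iota)
    (K : fieldType) (pi : {rmorphism V -> K}) (K_res : is_residue_field t pi)
    (n : nat) (Delta : scomplex n.+1) :
  (forall (a : 'I_n -> int) (i : int),
     let G := neg_support a in
     let Lambda := link Delta G in
     let H_a := submod_type (local_cohomology_deg t Delta i a) in
     [/\ (forall k, a k <= 0) -> G \in Delta ->
           isomorphic H_a
             (cohomology (dvr_sheaf iota pi Lambda) (i - #|G|%:Z - 1)),
         (forall k, a k <= 0) -> G \notin Delta -> is_zero_module H_a
       & (exists k, 0 < a k) -> is_zero_module H_a])
  /\
  (forall i : int,
     is_zero_module (local_cohomology t Delta i) <->
     (forall G : {set 'I_n.+1}, G \in Delta -> ord0 \notin G ->
        is_zero_module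
          (cohomology (dvr_sheaf iota pi (link Delta G)) (i - #|G|%:Z - 1)))).
Proof.
split=> [a i G Lambda H_a|i].
  split=> [a_le0 GD|a_le0 GD|[k ak]].
  - exact: (nonpositive_degree_iso V_dvr L_frac K_res a_le0 i GD).
  - exact: (nonface_degree_eq0 V_dvr a_le0 GD).
  - exact: (positive_degree_eq0 V_dvr L_frac K_res ak).
split=> [H0 G GD G0|H0].
  (* A nonpositive degree with negative support [G], available because [v_0] is not in [G]. *)
  pose a (j : 'I_n) : int := if lift ord0 j \in G then -1 else 0.
  have a_le0 k : a k <= 0 by rewrite /a; case: ifP.
  have aG : neg_support a = G.
    apply/setP => i'; case: (unliftP ord0 i') => [j|] ->.
      by rewrite mem_neg_support /a; case: ifP.
    by rewrite ord0_neg_support (negPf G0).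
  have := @nonpositive_degree_iso _ _ _ _ _ _ V_dvr L_frac K_res n Delta a a_le0 i.
  rewrite aG => /(_ GD)/isomorphic_eq0[+ _]; apply=> u.
  by apply: val_inj; apply: H0.
apply: (local_cohomology_eq0 V_dvr L_frac K_res) => a.
have [[k ak]|a_le0] := pselect (exists k, 0 < a k).
  exact: (positive_degree_eq0 V_dvr L_frac K_res ak).
have {}a_le0 k : a k <= 0.
  by rewrite leNgt; apply/negP => ak; apply: a_le0; exists k.
have [GD|GD] := boolP (neg_support a \in Delta); last first.
  exact: (nonface_degree_eq0 V_dvr a_le0 GD).
apply/(isomorphic_eq0 (nonpositive_degree_iso V_dvr L_frac K_res a_le0 i GD)).
by apply: H0 GD _; rewrite ord0_neg_support.
Qed.
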